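(* Let $(M,g)$ be a compact Riemannian manifold without boundary, $s>\dim(M)/2$, $(V_\alpha)_{\alpha\in I}$ an $L^2$-orthogonal refinement of the Laplace eigenspaces, $\Gamma$ an abelian group and $d:I\to\Gamma$ a channel-compatible map. Let $\Gamma_0:=\langle d(\alpha):\alpha\in I\rangle\le\Gamma$ be the subgroup generated by the degrees that occur. If $\Gamma_0$ is cyclic (e.g. $\Gamma_0\cong\mathbb{Z}$ or a finite cyclic group), then for every normalized unitary $2$-cocycle $\sigma$ on $\Gamma$ the commutator bicharacter $\beta_\sigma(p,q):=\sigma(p,q)\overline{\sigma(q,p)}$ is trivial on $\Gamma_0$, and hence the graded cocycle twist $\star_\sigma$ is commutative on $H^s_{\Gamma,\mathrm{fin}}$ (and on any Sobolev completion $H^s(M)$ to which $\star_\sigma$ extends as a bounded bilinear map).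
   Context: $\Delta$ is the (nonnegative) Laplace–Beltrami operator on complex-valued functions, with discrete spectrum, finite-dimensional eigenspaces $E_\lambda\subset C^\infty(M)$, orthogonal projections $P_\lambda$, and $E_{\mathrm{fin}}:=\bigoplus^{\mathrm{alg}}_\lambda E_\lambda$. $H^s(M)$ is the completion of $E_{\mathrm{fin}}$ for $\|f\|_{H^s}^2=\sum_\lambda(1+\lambda)^s\|P_\lambda f\|_{L^2}^2$; for $s>\dim(M)/2$ it is a Banach algebra under pointwise multiplication. Refinement: $(V_\alpha)_{\alpha\in I}$ is a countable family of finite-dimensional subspaces, pairwise orthogonal in $L^2(M)$, with $V_\alpha\subseteq E_{\lambda(\alpha)}$ for some $\lambda(\alpha)\in\mathrm{Spec}(\Delta)$ and $\bigoplus^{\mathrm{alg}}_\alpha V_\alpha=E_{\mathrm{fin}}$. Let $P_\alpha$ be the $L^2$-orthogonal projection onto $V_\alpha$. Write $\alpha\otimes\beta\rightsquigarrow\gamma$ if the map $V_\alpha\times V_\beta\to V_\gamma$, $(f,g)\mapsto P_\gamma(fg)$, is not identically zero. A map $d:I\to\Gamma$ is channel-compatible if $d(\gamma)=d(\alpha)+d(\beta)$ whenever $\alpha\otimes\beta\rightsquigarrow\gamma$. For $p\in\Gamma$: $L^2_p$ is the $L^2$-closure of $\bigoplus^{\mathrm{alg}}_{d(\alpha)=p}V_\alpha$; $H^s_p:=H^s(M)\cap L^2_p$; $H^s_{\Gamma,\mathrm{fin}}:=\bigoplus^{\mathrm{alg}}_{p\in\Gamma}H^s_p$. (One has $H^s_p\cdot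 H^s_q\subseteq H^s_{p+q}$.) With $\mathbb{T}=\{z\in\mathbb{C}:|z|=1\}$, a normalized unitary $2$-cocycle is $\sigma:\Gamma\times\Gamma\to\mathbb{T}$ with $\sigma(p,0)=\sigma(0,p)=1$ and $\sigma(p,q)\sigma(p+q,r)=\sigma(q,r)\sigma(p,q+r)$. The graded cocycle twisted product on $H^s_{\Gamma,\mathrm{fin}}$ is $f\star_\sigma g:=\sigma(p,q)fg$ for $f\in H^s_p$, $g\in H^s_q$, extended bilinearly. *)

(* Defs.v *)
From HB Require Import structures.
From mathcomp Require Import all_boot all_order all_algebra.
From mathcomp Require Import all_classical all_reals all_analysis.
From mathcomp Require Import complex.

Set Implicit Arguments.
Unset Strict Implicit.
Unset Printing Implicit Defensive.

Import Order.TTheory GRing.Theory Num.Theory.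
Import numFieldNormedType.Exports.

Local Open Scope classical_set_scope.
Local Open Scope ring_scope.

(** * Smooth functions and iterated integrals on R^n *)

Section Euclidean.
Context {R : realType}.

Definition partial n (i : 'I_n) (f : 'rV[R]_n -> R) : 'rV[R]_n -> R :=
  fun v => 'D_(delta_mx 0 i) f v.

(* [Ck_on k U f]: all partial derivatives of f of order k exist and are
   continuous at every point of the open set U. *)
Fixpoint Ck_on n (k : nat) (U : set 'rV[R]_n) (f : 'rV[R]_n -> R) : Prop :=
  if k is k'.+1 then
    forall i : 'I_n, (forall v, U v -> derivable f v (delta_mx 0 i)) /\
                     Ck_on k' U (partial i f)
  else forall v, U v -> {for v, continuous f}.

Definition smooth_on n (U : set 'rV[R]_n) (f : 'rV[R]_n -> R) : Prop :=
  forall k, Ck_on k U f.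

(* For a nonnegative Borel function h this is its integral against
   n-dimensional Lebesgue measure, by Tonelli. *)
Fixpoint iter_integral (n : nat) : ('rV[R]_n -> \bar R) -> \bar R :=
  match n return ('rV[R]_n -> \bar R) -> \bar R with
  | 0 => fun h => h 0
  | n'.+1 => fun h =>
      (\int[@lebesgue_measure R]_x
         iter_integral (fun v : 'rV[R]_n' => h (row_mx (x%:M : 'rV[R]_1) v)))%E
  end.

End Euclidean.

(** * Compact Riemannian manifolds without boundary *)

Definition borelType (M : ptopologicalType) := g_sigma_algebraType (@open M).

Section Manifold.
Variables (R : realType) (n : nat).

(* The values of [chart_map] outside [chart_dom], and of [chart_inv] outside
   the image of the chart, are irrelevant. *)
Record chart (M : topologicalType) := Chart {
  chart_dom : set M;
  chart_map : M -> 'rV[R]_n;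
  chart_inv : 'rV[R]_n -> M;
  chart_dom_open : open chart_dom;
  chart_img_open : open (chart_map @` chart_dom);
  chart_mapK : forall x, chart_dom x -> chart_inv (chart_map x) = x;
  chart_map_continuous : forall x, chart_dom x -> {for x, continuous chart_map};
  chart_inv_continuous : forall v, (chart_map @` chart_dom) v ->
    {for v, continuous chart_inv} }.

Definition chart_img M (a : chart M) : set 'rV[R]_n :=
  chart_map a @` chart_dom a.

Definition transition M (a b : chart M) : 'rV[R]_n -> 'rV[R]_n :=
  chart_map b \o chart_inv a.

Definition overlap M (a b : chart M) : set 'rV[R]_n :=
  chart_map a @` (chart_dom a `&` chart_dom b).

(* [metric_in a v] is the Gram matrix of the metric in the chart a, at the
   point of coordinates v.  The Riemannian volume [vol] is a field, but it is
   uniquely determined by [volE]: finitely many charts cover the manifold.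
   Second countability follows from compactness.  The measure theory library
   needs a pointed type, so the manifold is nonempty. *)
Record compact_riemannian_manifold := CompactRiemannianManifold {
  points :> ptopologicalType;
  points_hausdorff : hausdorff_space points;
  points_compact : compact [set: points];
  chart_index : Type;
  chart_of : chart_index -> chart points;
  chart_at : points -> chart_index;
  chart_atP : forall x, chart_dom (chart_of (chart_at x)) x;
  transition_smooth : forall (a b : chart_index) (j : 'I_n),
    smooth_on (overlap (chart_of a) (chart_of b))
      (fun v => transition (chart_of a) (chart_of b) v 0 j);
  metric_in : chart_index -> 'rV[R]_n -> 'M[R]_n;
  metric_sym : forall a v, chart_img (chart_of a) v ->
    (metric_in a v)^T = metric_in a v;
  metric_pos : forall a v (u : 'rV[R]_n), chart_img (chart_of a) v -> u != 0 ->
    0 < (u *m metric_in a v *m u^T) 0 0;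
  metric_smooth : forall a (i j : 'I_n),
    smooth_on (chart_img (chart_of a)) (fun v => metric_in a v i j);
  metric_change : forall a b v, overlap (chart_of a) (chart_of b) v ->
    let f := transition (chart_of a) (chart_of b) in
    metric_in a v = 'J f v *m metric_in b (f v) *m ('J f v)^T;
  vol : {measure set (borelType points) -> \bar R};
  volE : forall a (B : set (borelType points)), measurable B ->
    B `<=` chart_dom (chart_of a) ->
    vol B = iter_integral (fun v : 'rV[R]_n =>
      if `[< (chart_map (chart_of a) @` B) v >]
      then (Num.sqrt (\det (metric_in a v)))%:E else 0%E) }.

End Manifold.

(** * Laplacian, L^2 and Sobolev spaces *)

Section Analysis.
Context {R : realType} {n : nat}.
Variable M : compact_riemannian_manifold R n.

Local Notation fn := (M -> R[i]).

Definition re_part (f : fn) : M -> R := fun x => complex.Re (f x).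
Definition im_part (f : fn) : M -> R := fun x => complex.Im (f x).

Definition in_chart (a : chart_index M) (u : M -> R) : 'rV[R]_n -> R :=
  u \o chart_inv (chart_of a).

Definition smooth (f : fn) : Prop := forall a : chart_index M,
  smooth_on (chart_img (chart_of a)) (in_chart a (re_part f)) /\
  smooth_on (chart_img (chart_of a)) (in_chart a (im_part f)).

(* - |G|^(-1/2) d_i (|G|^(1/2) G^(ij) d_j u) *)
Definition beltrami (G : 'rV[R]_n -> 'M[R]_n) (u : 'rV[R]_n -> R) (v : 'rV[R]_n) : R :=
  - (Num.sqrt (\det (G v)))^-1 *
    \sum_(i < n) partial i (fun w => Num.sqrt (\det (G w)) *
                              \sum_(j < n) invmx (G w) i j * partial j u w) v.

(* On smooth functions the value does not depend on the chart at x. *)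
Definition laplacian (f : fn) : fn := fun x =>
  let a := chart_at x in
  let v := chart_map (chart_of a) x in
  Complex (beltrami (metric_in a) (in_chart a (re_part f)) v)
          (beltrami (metric_in a) (in_chart a (im_part f)) v).

Definition laplace_eigenspace (l : R) : set fn :=
  [set f | smooth f /\ laplacian f = l%:C%C *: f].

(* The Laplacian is nonnegative and self-adjoint, so that its eigenvalues are
   nonnegative real numbers. *)
Definition spectrum : set R :=
  [set l | 0 <= l /\ exists2 f, laplace_eigenspace l f & f != 0].

Definition aeq (f g : fn) : Prop := {ae vol M, forall x, f x = g x}.

Definition inL2 : set fn :=
  [set f | [/\ measurable_fun [set: borelType M] (re_part f),
               measurable_fun [set: borelType M] (im_part f) &
               (\int[vol M]_x (re_part f x ^+ 2 + im_part f x ^+ 2)%:E < +oo)%E]].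

Definition dot (f g : fn) : R[i] :=
  let h : fn := fun x => f x * (g x)^* in
  Complex (\int[vol M]_x re_part h x) (\int[vol M]_x im_part h x).

Definition L2norm (f : fn) : R := Num.sqrt (complex.Re (dot f f)).

Definition L2closure (W : set fn) : set fn :=
  [set f | inL2 f /\
     forall e : R, 0 < e -> exists2 h, W h & L2norm (f - h) < e].

Definition findim_subspace (V : set fn) : Prop :=
  exists (m : nat) (b : 'I_m -> fn),
    V = [set f | exists c : 'I_m -> R[i], f = \sum_(i < m) c i *: b i].

(* The orthogonal projection of f onto V, when it exists (always so for V
   finite-dimensional); the spaces V in use consist of smooth functions, so
   that it is unique as a function. *)
Definition proj (V : set fn) (f : fn) : fn :=
  xget 0 [set h | V h /\ forall k, V k -> dot (f - h) k = 0].

(* The algebraic sum of the subspaces V j, j in A; it is direct whenever these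
   are pairwise orthogonal spaces of smooth functions. *)
Definition algsum (J : choiceType) (A : set J) (V : J -> set fn) : set fn :=
  [set f | exists (r : seq J) (c : J -> fn),
     (forall j, j \in r -> A j /\ V j (c j)) /\ f = \sum_(j <- r) c j].

Definition Efin : set fn := algsum spectrum laplace_eigenspace.

Definition Efin_norm (s : R) (f : fn) : R :=
  Num.sqrt (fine (\esum_(l in spectrum)
    ((1 + l) `^ s * L2norm (proj (laplace_eigenspace l) f) ^+ 2)%:E)).

(* For s >= 0 the H^s norm dominates the L^2 norm, and the completion of Efin
   is realized inside L^2: its elements are the L^2-limits of the sequences in
   Efin which are Cauchy for the H^s norm. *)
Definition Hs_approx (s : R) (f : fn) (e : nat -> fn) : Prop :=
  [/\ forall k, Efin (e k),
      forall eps : R, 0 < eps -> exists N : nat, forall j k : nat,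
        (N <= j)%N -> (N <= k)%N -> Efin_norm s (e j - e k) < eps,
      inL2 f &
      (fun k => L2norm (f - e k)) @ \oo --> (0 : R)].

Definition Hs (s : R) : set fn := [set f | exists e, Hs_approx s f e].

Definition Hs_norm (s : R) (f : fn) : R :=
  xget 0 [set r | exists2 e, Hs_approx s f e &
                    (fun k => Efin_norm s (e k)) @ \oo --> r].

(* Functions stand for their classes modulo [aeq]; such a B is automatically
   compatible with [aeq]. *)
Definition bounded_bilinear (s : R) (B : fn -> fn -> fn) : Prop :=
  [/\ forall f g, Hs s f -> Hs s g -> Hs s (B f g),
      forall (a : R[i]) f f' g, Hs s f -> Hs s f' -> Hs s g ->
        aeq (B (a *: f + f') g) (a *: B f g + B f' g),
      forall (a : R[i]) f g g', Hs s f -> Hs s g -> Hs s g' ->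
        aeq (B f (a *: g + g')) (a *: B f g + B f g') &
      exists C : R, forall f g, Hs s f -> Hs s g ->
        Hs_norm s (B f g) <= C * Hs_norm s f * Hs_norm s g].

(** * Refinements, gradings and twists *)

Definition is_refinement (I : countType) (V : I -> set fn) : Prop :=
  [/\ forall a, findim_subspace (V a),
      forall a, exists2 l, spectrum l & V a `<=` laplace_eigenspace l,
      forall a b, a != b -> forall f g, V a f -> V b g -> dot f g = 0 &
      algsum [set: I] V = Efin].

Definition channel (I : countType) (V : I -> set fn) (a b c : I) : Prop :=
  exists f g, [/\ V a f, V b g & proj (V c) (f \* g) != 0].

Definition channel_compatible (I : countType) (V : I -> set fn)
    (G : zmodType) (d : I -> G) : Prop :=
  forall a b c, channel V a b c -> d c = d a + d b.

Section Graded.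
Context {I : countType} {G : zmodType}.
Variables (V : I -> set fn) (d : I -> G) (s : R).

Definition L2_deg (p : G) : set fn := L2closure (algsum [set a | d a = p] V).

Definition Hs_deg (p : G) : set fn := Hs s `&` L2_deg p.

Definition homogeneous_decomposition (f : fn) (c : G -> fn) : Prop :=
  [/\ forall p, Hs_deg p (c p),
      finite_set [set p | c p != 0] &
      aeq f (\sum_(p \in [set: G]) c p)].

Definition Hs_graded_fin : set fn :=
  [set f | exists c, homogeneous_decomposition f c].

(* Unique up to [aeq] in each degree, since the L2_deg p are pairwise
   orthogonal. *)
Definition hcomp (f : fn) : G -> fn :=
  xget (fun=> 0) [set c | homogeneous_decomposition f c].

Definition star (sigma : G -> G -> R[i]) (f g : fn) : fn :=
  \sum_(p \in [set: G]) \sum_(q \in [set: G])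
     sigma p q *: (hcomp f p \* hcomp g q).

End Graded.
End Analysis.

(** * Subgroups and 2-cocycles *)

Section Groups.
Variable G : zmodType.

Definition is_subgroup (H : set G) : Prop :=
  H 0 /\ forall p q, H p -> H q -> H (p - q).

Definition generated_subgroup (S : set G) : set G :=
  [set p | forall H : set G, is_subgroup H -> S `<=` H -> H p].

Definition cyclic_subgroup (H : set G) : Prop :=
  exists c, H = range (fun z : int => c *~ z).

Definition unitary_2cocycle (R : realType) (sigma : G -> G -> R[i]) : Prop :=
  [/\ forall p q, `|sigma p q| = 1,
      forall p, sigma p 0 = 1 /\ sigma 0 p = 1 &
      forall p q r,
        sigma p q * sigma (p + q) r = sigma q r * sigma p (q + r)].

Definition commutator_bichar (R : realType) (sigma : G -> G -> R[i]) (p q : G) : R[i] :=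
  sigma p q * (sigma q p)^*.

End Groups.

(* Main.v *)
(* The commutator bicharacter b of a cocycle is bimultiplicative and alternating,
   hence trivial on a cyclic group; so sigma is symmetric on the degrees that occur,
   and the components in the other degrees vanish almost everywhere.  For the
   Sobolev completion, a bounded bilinear map that is commutative on the dense
   subspace Efin is commutative.

   Density has to be extracted from the concrete H^s norm.  The orthogonality of the
   refinement stands in for the self-adjointness of the Laplacian: it forces the
   eigenfunctions for l to expand along the V_a with eigenvalue l only, whence the
   H^s norm of a finite sum of c_a is the L^2 norm of the sum of (1 + l_a)^(s/2) c_a.
   This makes the norm closable in L^2, so that limits of norms along approximating
   sequences are well defined.  Besides, eigenfunctions are square-integrable, the
   volume being finite by compactness. *)
Require Import Defs.
From HB Require Import structures.
From mathcomp Require Import all_boot all_order all_algebra.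
From mathcomp Require Import all_classical all_reals all_analysis.
From mathcomp Require Import measurable_realfun complex.
From mathcomp Require Import ring lra.

Set Implicit Arguments.
Unset Strict Implicit.
Unset Printing Implicit Defensive.

Import Order.TTheory GRing.Theory Num.Theory.
Import numFieldNormedType.Exports.

Local Open Scope classical_set_scope.
Local Open Scope ring_scope.

(** * The commutator bicharacter *)

(** Two features of the definitions shape the analytic half. [proj], [Hs_norm] and [hcomp] are
    choices made by [xget], so candidates must first be shown to exist, and what is then proved
    about them has to hold whichever candidate was picked. And the H^s norm is built from
    projections onto full Laplace eigenspaces, while orthogonality is given for the [V a]; every
    computation with it therefore goes through coordinates along the [V a], on which functions of
    the Laplacian act as diagonal weights.

    For a bounded extension [B], the defect [B f g - B g f] is estimated in L^2, where a vanishing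
    norm means vanishing almost everywhere. The H^s bound on [B] enters there because the L^2 norm
    is at most the H^s norm, all weights [(1 + l) ^ s] being at least [1]. The agreement of [B] with
    [star] can be used on [Efin] because a finite expansion along the [V a], grouped by degree, is a
    homogeneous decomposition. *)

Section Cocycle.
Variables (R : realType) (G : zmodType) (sigma : G -> G -> R[i]).
Hypothesis hsigma : unitary_2cocycle sigma.

Let b := commutator_bichar sigma.

Lemma cocycle_neq0 p q : sigma p q != 0.
Proof. by rewrite -normr_eq0; case: hsigma => -> _ _; rewrite oner_eq0. Qed.

(** Unimodularity turns the conjugate into an inverse, so the laws of the bicharacter become
    rational identities between values of [sigma]. *)
Lemma commutator_bichar_div p q : b p q = sigma p q / sigma q p.
Proof.
have [h _ _] := hsigma.
by rewrite /b /commutator_bichar invC_norm h expr1n invr1 mul1r.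
Qed.

Lemma commutator_bicharDl p q r : b (p + q) r = b p r * b q r.
Proof.
have [_ _ h] := hsigma.
rewrite !commutator_bichar_div.
have := h p q r; have := h p r q; have := h r p q.
rewrite [p + r]addrC [r + q]addrC.
have := cocycle_neq0 r (p + q); have := cocycle_neq0 r p.
have := cocycle_neq0 r q; have := cocycle_neq0 p q.
have := cocycle_neq0 p (q + r). have := cocycle_neq0 (r + p) q.
move: (sigma r (p + q)) (sigma r p) (sigma r q) (sigma p q) (sigma p (q + r))
  (sigma (r + p) q) (sigma (p + q) r) (sigma p r) (sigma q r).
move=> A B C D E F K L N F0 E0 D0 C0 B0 A0 h1 h2 h3.
(* The cocycle identity for the orderings [(p, q, r)], [(r, p, q)] and [(p, r, q)] is solved for one
   value each; both sides then reduce to [N * E / (B * F)]. *)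
have -> : K = N * E / D by rewrite -h3 mulrAC divff ?mul1r.
have -> : A = B * F / D by rewrite h1 mulrAC divff ?mul1r.
have -> : L = C * E / F by rewrite -h2 mulfK.
by field; rewrite F0 D0 C0 B0.
Qed.

Lemma commutator_bicharxx p : b p p = 1.
Proof. by rewrite commutator_bichar_div divff ?cocycle_neq0. Qed.

Lemma commutator_bicharC p q : b p q * b q p = 1.
Proof.
by rewrite !commutator_bichar_div -mulrA mulKf ?divff ?cocycle_neq0.
Qed.

Lemma commutator_bichar_mulz p q z : b p q = 1 -> b (p *~ z) q = 1.
Proof.
move=> bpq.
(* Additivity makes [b 0 q] idempotent, and antisymmetry excludes the value [0]. *)
have b0 : b 0 q = 1.
  have /eqP := commutator_bicharDl 0 0 q; rewrite addr0 eq_sym -subr_eq0.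
  rewrite -{3}[b 0 q]mulr1 -mulrBr mulf_eq0 subr_eq0 => /orP[|/eqP //].
  by move=> /eqP b0; have := commutator_bicharC 0 q; rewrite b0 mul0r => /esym/eqP; rewrite oner_eq0.
have bn n : b (p *+ n) q = 1.
  by elim: n => [|n IH] //; rewrite mulrS commutator_bicharDl bpq IH mul1r.
case: z => n; first exact: bn.
have := commutator_bicharDl (p *+ n.+1) (p *~ Negz n) q.
by rewrite NegzE mulrNz subrr b0 bn mul1r => <-.
Qed.

(** Both arguments are multiples of one generator [c], so everything comes down to [b c c = 1].
    Additivity is available in the first slot; [commutator_bicharC] carries it to the second. *)
Lemma commutator_bichar_cyclic (H : set G) p q :
  cyclic_subgroup H -> H p -> H q -> b p q = 1.
Proof.
move=> [c ->] [y _ <-] [z _ <-].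
apply: commutator_bichar_mulz.
have /(commutator_bichar_mulz z) h := commutator_bicharxx c.
by have := commutator_bicharC c (c *~ z); rewrite h mulr1.
Qed.

Lemma cocycle_sym p q : b p q = 1 -> sigma p q = sigma q p.
Proof.
by rewrite commutator_bichar_div => /(canRL (divfK (cocycle_neq0 q p))); rewrite mul1r.
Qed.

End Cocycle.

(** * Smooth functions are square-integrable *)

Section UpperIntegral.
Import HBNNSimple.

(* The integral of a nonnegative function is a supremum over the simple functions
   below it, so no measurability is needed. *)
Lemma le_integral_ge0 d (T : measurableType d) (R : realType)
    (mu : {measure set T -> \bar R}) (f g : T -> \bar R) :
  (forall x, 0 <= f x)%E -> (forall x, f x <= g x)%E ->
  (\int[mu]_x f x <= \int[mu]_x g x)%E.
Proof.
move=> f0 fg.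
have g0 x : (0 <= g x)%E by rewrite (le_trans (f0 x)).
rewrite !ge0_integralTE //; apply: ereal_sup_le => _ [h /= hf <-].
by exists h => // x; exact: (le_trans (hf x)).
Qed.

End UpperIntegral.

(** * Iterated integrals of functions supported in a cube *)

Section Box.
Variable R : realType.

Lemma iter_integral_ge0 n (h : 'rV[R]_n -> \bar R) :
  (forall w, 0 <= h w)%E -> (0 <= iter_integral h)%E.
Proof.
elim: n h => [|n IH] h h0 /=; first exact: h0.
by apply: integral_ge0 => x _; apply: IH.
Qed.

(** Induction on the dimension: the inner integral is at most [K * (r *+ 2) ^+ n] for a first
    coordinate within [r] of [v 0 0] and vanishes otherwise. Monotonicity without measurability lets
    [h] be arbitrary. *)
Lemma iter_integral_box n (h : 'rV[R]_n -> \bar R) (v : 'rV[R]_n) (r K : R) :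
  0 <= r -> 0 <= K ->
  (forall w, 0 <= h w <= K%:E)%E ->
  (forall w, h w != 0%E -> forall i, `|v 0 i - w 0 i| <= r) ->
  (iter_integral h <= (K * (r *+ 2) ^+ n)%:E)%E.
Proof.
move=> r0; elim: n h v K => [|n IH] h v K K0 hK hv /=.
  by rewrite expr0 mulr1; case/andP: (hK 0).
set a := v 0 0; set C := K * (r *+ 2) ^+ n.
have C0 : 0 <= C by rewrite mulr_ge0 ?exprn_ge0 ?mulrn_wge0.
have ab : (a - r <= a + r)%R by rewrite lerD2l ge0_cp.
apply: (@le_trans _ _ (\int[@lebesgue_measure R]_x (C%:E * (\1_(`[a - r, a + r]%classic) x)%:E))%E).
  apply: le_integral_ge0 => x.
    by apply: iter_integral_ge0 => w; case/andP: (hK (row_mx x%:M w)).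
  have E w : row_mx (x%:M : 'rV[R]_1) w 0 0 = x :> R.
    have := row_mxEl (x%:M : 'rV[R]_1) w 0 0; rewrite [_%:M _ _]mxE eqxx mulr1n => e.
    by rewrite -[RHS]e; congr (row_mx _ _ _ _); exact/val_inj.
  have [xI|xI] := boolP (x \in `[a - r, a + r]).
    rewrite indicE mem_set // mule1.
    apply: (IH _ (rsubmx (v : 'rV_(1 + n)))) => // w.
    move=> /hv hw i; have := hw (rshift 1 i).
    have -> := row_mxEr (x%:M : 'rV_1) w 0 i.
    by rewrite [rsubmx _ _ _]mxE.
  rewrite indicE memNset ?mule0; last by move=> /= H; rewrite H in xI.
  (* Outside the interval the slice of [h] is identically zero, which is the induction hypothesis
     with bound [0] in place of [K]. *)
  have -> : (0 : \bar R)%E = (0 * (r *+ 2) ^+ n)%:E by rewrite mul0r.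
  apply: (IH _ 0) => //.
    move=> w; case: (eqVneq (h (row_mx x%:M w)) 0%E) => [->|/hv hw]; first by rewrite lexx.
    case/negP: xI; have := hw 0.
    by rewrite E in_itv /= -/a ler_distlC.
  move=> w /hv hw; case/negP: xI; have := hw 0.
  by rewrite E in_itv /= -/a ler_distlC.
rewrite ge0_integralZl //=; last exact/measurable_EFinP/measurable_indic.
rewrite integral_indic // setIT [X in (_ * X <= _)%E](lebesgue_measure_itv `[a - r, a + r]) /= lte_fin.
case: ifPn => _; last by rewrite mule0 lee_fin mulr_ge0 ?exprn_ge0 ?mulrn_wge0.
rewrite -EFinD -EFinM lee_fin /C exprSr mulrA ler_wpM2l //.
by have -> : a + r - (a - r) = r *+ 2 by ring.
Qed.
End Box.

Lemma continuous_at_eq_on (T W : topologicalType) (U : set T) (f g : T -> W) v :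
  open U -> U v -> (forall w, U w -> f w = g w) ->
  {for v, continuous f} -> {for v, continuous g}.
Proof.
move=> oU Uv fg; change (f @ v --> f v -> g @ v --> g v).
rewrite -(fg v Uv); apply: cvg_trans.
apply: near_eq_cvg; have : nbhs v U by apply: open_nbhs_nbhs.
by apply: filterS => w /fg.
Qed.

Section SmoothL2.
Variables (R : realType) (n : nat) (M : compact_riemannian_manifold R n).

Lemma smooth_on_continuous (U : set 'rV[R]_n) (f : 'rV[R]_n -> R) v :
  smooth_on U f -> U v -> {for v, continuous f}.
Proof. by move=> /(_ 0%N) /= h; apply: h. Qed.

Lemma in_chart_continuous (u : M -> R) :
  (forall a : chart_index M, smooth_on (chart_img (chart_of a)) (in_chart a u)) ->
  continuous u.
Proof.
move=> hu x; pose a := chart_at x.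
have ax : chart_dom (chart_of a) x := chart_atP x.
have oa : open (chart_dom (chart_of a)) by exact: chart_dom_open.
apply: (@continuous_at_eq_on _ _ _ (in_chart a u \o chart_map (chart_of a)) _ _ oa ax).
  by move=> y ay; rewrite /in_chart /= chart_mapK.
apply: continuous_comp; first exact: chart_map_continuous.
by apply: smooth_on_continuous (hu a) _; exists x.
Qed.

Lemma continuous_borel_measurable (u : M -> R) :
  continuous u -> measurable_fun [set: borelType M] u.
Proof.
move=> /continuousP cu; apply: (measurability _ (RGenOpens.measurableE R)).
move=> _ [_ [a [b ->] <-]]; rewrite setTI.
by apply: sub_sigma_algebra; apply: cu; exact: interval_open.
Qed.

Lemma continuous_bounded (u : M -> R) : continuous u -> exists K, forall x, `|u x| <= K.
Proof.
move=> cu.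
have : compact (u @` [set: M]).
  by apply: continuous_compact; [exact: continuous_subspaceT | exact: points_compact].
move=> /compact_bounded [K [_ hK]]; exists (K + 1) => x.
by apply: (hK (K + 1)); [rewrite ltrDl | exists x].
Qed.
End SmoothL2.

(** * Finiteness of the Riemannian volume *)

Section Det.
Variables (R : realType) (n : nat).

Lemma det_continuous (T : topologicalType) (x : T) (G : T -> 'M[R]_n) :
  (forall i j, {for x, continuous (fun y => G y i j)}) ->
  {for x, continuous (fun y => \det (G y))}.
Proof.
move=> hG; rewrite /continuous_at /determinant.
apply: cvg_big => [|s _]; first exact: add_continuous.
apply: cvgM; first exact: cvg_cst.
by apply: cvg_big => [|i _]; [exact: mul_continuous | exact: hG].
Qed.
End Det.

Section Volume.
Variables (R : realType) (n : nat) (M : compact_riemannian_manifold R n).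

(** Near a point the density is bounded and the coordinates stay in a cube, so the formula [volE] in
    one chart is controlled by [iter_integral_box]. *)
Lemma vol_locally_finite (x : M) :
  exists B : set M, [/\ open B, B x & (vol M B < +oo)%E].
Proof.
pose a := chart_at x; pose v := chart_map (chart_of a) x.
have ax : chart_dom (chart_of a) x := chart_atP x.
have imgv : chart_img (chart_of a) v by exists x.
pose S w := Num.sqrt (\det (metric_in a w)).
have cS : {for v, continuous S}.
  apply: continuous_comp; last exact: sqrt_continuous.
  apply: det_continuous => i j.
  exact: smooth_on_continuous (metric_smooth a i j) imgv.
(* The two conditions supply the bound [S v + 1] and the radius [1] for [iter_integral_box]; the
   ball of row vectors is taken entrywise, hence a cube. *)
pose W : set 'rV[R]_n := [set w | S w <= S v + 1 /\ ball v 1 w].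
have nW : nbhs v W.
  apply: filterI; last exact: nbhsx_ballx.
  have : nbhs (S v) [set y | y <= S v + 1].
    by apply: lt_le_nbhsl; rewrite ltrDl.
  exact: cS.
pose D : set M := chart_dom (chart_of a) `&` chart_map (chart_of a) @^-1` W.
have nD : nbhs x D.
  apply: filterI; first by apply: open_nbhs_nbhs; split => //; exact: chart_dom_open.
  exact: (chart_map_continuous ax nW).
(* [D] need not be open; its interior is, hence it is Borel, as [volE] requires. *)
exists D^°; split; [exact: open_interior | exact: nD | ].
have sD : D^° `<=` D by exact: interior_subset.
rewrite (volE (a := a)); last 2 first.
- by apply: sub_sigma_algebra; exact: open_interior.
- by move=> y /sD [].
apply: (@le_lt_trans _ _ ((S v + 1) * (1 *+ 2) ^+ n)%:E); last exact: ltry.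
apply: (@iter_integral_box _ _ _ v 1 (S v + 1)) => //.
- by rewrite addr_ge0 ?sqrtr_ge0.
- move=> w; case: asboolP => [[y /sD [_ [yK _]] <-]|_]; last by rewrite !lee_fin lexx addr_ge0 ?sqrtr_ge0.
  by rewrite !lee_fin sqrtr_ge0.
- move=> w; case: asboolP => [[y /sD [_ [_ yb]] <-] _ i|]; last by rewrite eqxx.
  by apply: ltW; case: yb => _ yb; exact: (yb 0 i).
Qed.

Lemma vol_finite : (vol M [set: M] < +oo)%E.
Proof.
have [B hB] := choice vol_locally_finite.
have := @points_compact _ _ M; rewrite compact_cover => /(_ M [set: M] B).
case=> [x _|x _|D' _ hD]; first by case: (hB x).
  by exists x => //; case: (hB x).
have mB x : measurable (B x : set (borelType M)).
  by apply: sub_sigma_algebra; case: (hB x).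
suff [mU fU] : measurable (\big[setU/set0]_(x <- finmap.enum_fset D') B x : set (borelType M)) /\
    (vol M (\big[setU/set0]_(x <- finmap.enum_fset D') B x) < +oo)%E.
  apply: le_lt_trans fU; apply: le_measure; rewrite ?inE //.
  by move=> x /hD; rewrite /cover bigcup_fset.
elim: (finmap.enum_fset D') => [|x r [mU fU]].
  by rewrite big_nil measure0; split => //; exact: measurable0.
rewrite big_cons; split; first exact: measurableU.
apply: le_lt_trans; first exact: measureU2.
by rewrite lte_add_pinfty //; case: (hB x).
Qed.

Lemma smooth_inL2 (f : M -> R[i]) : smooth f -> inL2 f.
Proof.
move=> hf.
have cre : continuous (re_part f) by apply: in_chart_continuous => a; case: (hf a).
have cim : continuous (im_part f) by apply: in_chart_continuous => a; case: (hf a).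
split; [exact: continuous_borel_measurable | exact: continuous_borel_measurable | ].
have [K hK] := continuous_bounded cre; have [L hL] := continuous_bounded cim.
apply: (@le_lt_trans _ _ (\int[vol M]_x (K ^+ 2 + L ^+ 2)%:E)%E).
  apply: le_integral_ge0 => x; rewrite lee_fin; first by rewrite addr_ge0 ?sqr_ge0.
  by rewrite lerD // -real_normK ?num_real // lerXn2r ?nnegrE // (le_trans _ (hK x), le_trans _ (hL x)).
rewrite integral_cst //; apply: lte_mul_pinfty => //; last exact: vol_finite.
by rewrite lee_fin addr_ge0 ?sqr_ge0.
Qed.
End Volume.

(** * Sesquilinearity of the L^2 product *)

Section L2.
Variables (R : realType) (n : nat) (M : compact_riemannian_manifold R n).
Local Notation fn := (M -> R[i]).
Local Notation mu := (vol M).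
Implicit Types (f g h : fn) (c : R[i]).

Lemma aeS (P Q : M -> Prop) : (forall x, P x -> Q x) ->
  {ae mu, forall x, P x} -> {ae mu, forall x, Q x}.
Proof. exact: (@filterS _ _ (ae_filter_ringOfSetsType mu)). Qed.

Lemma aeI (P Q : M -> Prop) : {ae mu, forall x, P x} -> {ae mu, forall x, Q x} ->
  {ae mu, forall x, P x /\ Q x}.
Proof. exact: (@filterI _ _ (ae_filter_ringOfSetsType mu)). Qed.

Lemma re_partE c f g x : re_part (c *: f + g) x =
  complex.Re c * re_part f x - complex.Im c * im_part f x + re_part g x.
Proof.
rewrite /re_part /im_part; change ((c *: f + g) x) with (c * f x + g x).
by case: c (f x) (g x) => [a b] [p q] [r t].
Qed.

Lemma im_partE c f g x : im_part (c *: f + g) x =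
  complex.Re c * im_part f x + complex.Im c * re_part f x + im_part g x.
Proof.
rewrite /re_part /im_part; change ((c *: f + g) x) with (c * f x + g x).
by case: c (f x) (g x) => [a b] [p q] [r t].
Qed.

Lemma re_mulconj f g x : re_part (fun y => f y * (g y)^* ) x =
  re_part f x * re_part g x + im_part f x * im_part g x.
Proof. by rewrite /re_part /im_part; case: (f x) (g x) => [a b] [p q] /=; ring. Qed.

Lemma im_mulconj f g x : im_part (fun y => f y * (g y)^* ) x =
  im_part f x * re_part g x - re_part f x * im_part g x.
Proof. by rewrite /re_part /im_part; case: (f x) (g x) => [a b] [p q] /=; ring. Qed.

Definition sq_integrable (u : M -> R) :=
  measurable_fun [set: borelType M] u /\ (\int[mu]_x (u x ^+ 2)%:E < +oo)%E.

Lemma inL2_re f : inL2 f -> sq_integrable (re_part f).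
Proof.
move=> [mr _ fi]; split => //; apply: le_lt_trans fi.
by apply: le_integral_ge0 => x; rewrite lee_fin ?sqr_ge0 // lerDl sqr_ge0.
Qed.

Lemma inL2_im f : inL2 f -> sq_integrable (im_part f).
Proof.
move=> [_ mi fi]; split => //; apply: le_lt_trans fi.
by apply: le_integral_ge0 => x; rewrite lee_fin ?sqr_ge0 // lerDr sqr_ge0.
Qed.

Lemma sq_integrable_inL2 f :
  sq_integrable (re_part f) -> sq_integrable (im_part f) -> inL2 f.
Proof.
move=> [mr fr] [mi fi]; split => //.
under eq_integral do rewrite EFinD.
rewrite ge0_integralD //; first by rewrite lte_add_pinfty.
- by move=> x _; rewrite lee_fin sqr_ge0.
- by apply/measurable_EFinP; exact: measurable_funX.
- by move=> x _; rewrite lee_fin sqr_ge0.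
- by apply/measurable_EFinP; exact: measurable_funX.
Qed.

Lemma sq_integrableM u w : sq_integrable u -> sq_integrable w ->
  mu.-integrable [set: borelType M] (EFin \o (fun x => u x * w x)).
Proof.
move=> [mu_ fu] [mw fw]; apply/integrableP; split.
  by apply/measurable_EFinP; exact: measurable_funM.
apply: (@le_lt_trans _ _ (\int[mu]_x ((u x ^+ 2)%:E + (w x ^+ 2)%:E))%E).
  apply: le_integral_ge0 => x //=; rewrite -EFinD lee_fin normrM.
  rewrite -[u x ^+ 2]real_normK ?num_real // -[w x ^+ 2]real_normK ?num_real //.
  by have := sqr_ge0 (`|u x| - `|w x|); have := normr_ge0 (u x); have := normr_ge0 (w x); nra.
rewrite ge0_integralD //; first by rewrite lte_add_pinfty.
- by move=> x _; rewrite lee_fin sqr_ge0.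
- by apply/measurable_EFinP; exact: measurable_funX.
- by move=> x _; rewrite lee_fin sqr_ge0.
- by apply/measurable_EFinP; exact: measurable_funX.
Qed.

Lemma sq_integrable_comb a b u w : sq_integrable u -> sq_integrable w ->
  sq_integrable (fun x => a * u x + b * w x).
Proof.
move=> [mu_ fu] [mw fw]; split.
  by apply: measurable_funD; apply: measurable_funM.
apply: (@le_lt_trans _ _ (\int[mu]_x ((2 * a ^+ 2)%:E * (u x ^+ 2)%:E + (2 * b ^+ 2)%:E * (w x ^+ 2)%:E))%E).
  apply: le_integral_ge0 => x //=; rewrite -?EFinM -?EFinD lee_fin ?sqr_ge0 //.
  by have := sqr_ge0 (a * u x - b * w x); nra.
have m2 (v : M -> R) : measurable_fun [set: borelType M] v ->
    measurable_fun [set: borelType M] (fun x => (v x ^+ 2)%:E).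
  by move=> mv; apply/measurable_EFinP; exact: measurable_funX.
have n2 (v : M -> R) r x : (0 <= (2 * r ^+ 2)%:E * (v x ^+ 2)%:E)%E.
  by rewrite -EFinM lee_fin mulr_ge0 ?sqr_ge0 // mulr_ge0 ?sqr_ge0.
have e2 (v : M -> R) r : measurable_fun [set: borelType M] v ->
    measurable_fun [set: borelType M] (fun x => (2 * r ^+ 2)%:E * (v x ^+ 2)%:E)%E.
  by move=> mv; apply: measurable_funeM; exact: m2.
rewrite ge0_integralD //; try exact: e2.
have p2 r : 0 <= 2 * r ^+ 2 :> R by rewrite mulr_ge0 ?sqr_ge0.
rewrite !ge0_integralZl_EFin ?p2 //; try exact: m2.
- by rewrite lte_add_pinfty // lte_mul_pinfty ?lee_fin ?p2.
- by move=> x _; rewrite lee_fin sqr_ge0.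
- by move=> x _; rewrite lee_fin sqr_ge0.
Qed.

Lemma inL2_lin c f g : inL2 f -> inL2 g -> inL2 (c *: f + g).
Proof.
move=> Lf Lg; apply: sq_integrable_inL2.
  have -> : re_part (c *: f + g) = (fun x => 1 * (complex.Re c * re_part f x +
      (- complex.Im c) * im_part f x) + 1 * re_part g x).
    by apply/funext => x; rewrite re_partE; ring.
  by apply: sq_integrable_comb; [apply: sq_integrable_comb|];
    (exact: inL2_re || exact: inL2_im).
have -> : im_part (c *: f + g) = (fun x => 1 * (complex.Re c * im_part f x +
    complex.Im c * re_part f x) + 1 * im_part g x).
  by apply/funext => x; rewrite im_partE; ring.
by apply: sq_integrable_comb; [apply: sq_integrable_comb|];
    (exact: inL2_re || exact: inL2_im).
Qed.

Lemma integrable_re f g : inL2 f -> inL2 g ->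
  mu.-integrable [set: borelType M] (EFin \o re_part (fun y => f y * (g y)^* )).
Proof.
move=> Lf Lg; rewrite (_ : EFin \o _ =
    (EFin \o (fun x => re_part f x * re_part g x)%R) \+
    (EFin \o (fun x => im_part f x * im_part g x)%R))%E; last first.
  by apply/funext => x /=; rewrite re_mulconj EFinD.
by apply: integrableD => //; apply: sq_integrableM; (exact: inL2_re || exact: inL2_im).
Qed.

Lemma integrable_im f g : inL2 f -> inL2 g ->
  mu.-integrable [set: borelType M] (EFin \o im_part (fun y => f y * (g y)^* )).
Proof.
move=> Lf Lg; rewrite (_ : EFin \o _ =
    (EFin \o (fun x => im_part f x * re_part g x)%R) \-
    (EFin \o (fun x => re_part f x * im_part g x)%R))%E; last first.
  by apply/funext => x /=; rewrite im_mulconj EFinB.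
by apply: integrableB => //; apply: sq_integrableM; (exact: inL2_re || exact: inL2_im).
Qed.

Lemma Rintegral_comb a b u w :
  mu.-integrable [set: borelType M] (EFin \o u) ->
  mu.-integrable [set: borelType M] (EFin \o w) ->
  \int[mu]_x (a * u x + b * w x) = a * \int[mu]_x u x + b * \int[mu]_x w x.
Proof.
move=> iu iw; rewrite RintegralD ?RintegralZl //.
  by have := integrableZl (measurableT) a iu; apply.
by have := integrableZl (measurableT) b iw; apply.
Qed.

Lemma dotDl c f g h : inL2 f -> inL2 g -> inL2 h ->
  dot (c *: f + g) h = c * dot f h + dot g h.
Proof.
move=> Lf Lg Lh; rewrite /dot.
set F := fun x => f x * _; set G := fun x => g x * _.
have -> : (fun x => (c *: f + g) x * (h x)^*) = c *: F + G.
  by apply/funext => x; change ((c * f x + g x) * (h x)^* = c * F x + G x); rewrite /F /G; ring.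
have iF := integrable_re Lf Lh; have jF := integrable_im Lf Lh.
have iG := integrable_re Lg Lh; have jG := integrable_im Lg Lh.
have icomb a b u w : mu.-integrable [set: borelType M] (EFin \o u) ->
    mu.-integrable [set: borelType M] (EFin \o w) ->
    mu.-integrable [set: borelType M] (EFin \o (fun x => a * u x + b * w x)).
  move=> iu iw; have := integrableD measurableT (integrableZl measurableT a iu) (integrableZl measurableT b iw).
  by apply: eq_integrable => // x _ /=.
have -> : re_part (c *: F + G) = (fun x => 1 * (complex.Re c * re_part F x +
      (- complex.Im c) * im_part F x) + 1 * re_part G x).
  by apply/funext => x; rewrite re_partE; ring.
have -> : im_part (c *: F + G) = (fun x => 1 * (complex.Re c * im_part F x +
      complex.Im c * re_part F x) + 1 * im_part G x).
  by apply/funext => x; rewrite im_partE; ring.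
rewrite !Rintegral_comb //; try exact: icomb.
by case: (c) => a b; apply/eqP; rewrite eq_complex /=; apply/andP; split; apply/eqP; ring.
Qed.

Lemma dotC f g : inL2 f -> inL2 g -> dot g f = (dot f g)^*.
Proof.
move=> Lf Lg; rewrite /dot.
have i1 := integrable_re Lf Lg; have i2 := integrable_im Lf Lg.
have -> : re_part (fun x => g x * (f x)^*) = re_part (fun x => f x * (g x)^*).
  by apply/funext => x; rewrite !re_mulconj; ring.
have -> : im_part (fun x => g x * (f x)^*) =
    (fun x => (-1) * im_part (fun x => f x * (g x)^*) x).
  by apply/funext => x; rewrite !im_mulconj; ring.
by rewrite RintegralZl // mulN1r.
Qed.

Lemma dot_re_im0 f : complex.Im (dot f f) = 0.
Proof.
rewrite /dot /= (_ : im_part _ = fun=> 0); last first.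
  by apply/funext => x; rewrite im_mulconj; ring.
by rewrite Rintegral_cst // mul0r.
Qed.

Lemma dot_re_ge0 f : 0 <= complex.Re (dot f f).
Proof.
rewrite /dot /=; apply: Rintegral_ge0 => x _.
by rewrite re_mulconj -!expr2 addr_ge0 ?sqr_ge0.
Qed.

Lemma L2norm_sqr f : (L2norm f ^+ 2)%:C%C = dot f f.
Proof.
rewrite /L2norm sqr_sqrtr ?dot_re_ge0 //.
by case: (dot f f) (dot_re_im0 f) => [p q] /= ->.
Qed.

Lemma L2norm_ge0 f : 0 <= L2norm f. Proof. exact: sqrtr_ge0. Qed.

Lemma L2norm_eq0 f : inL2 f -> L2norm f = 0 -> aeq f 0.
Proof.
move=> Lf /eqP; rewrite sqrtr_eq0 => h.
have f0 : complex.Re (dot f f) = 0 by apply/le_anti; rewrite h dot_re_ge0.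
have := integrable_re Lf Lf; set u := re_part _ => i1; have [m1 _] := integrableP _ _ _ i1.
have e1 : (\int[mu]_x `|(u x)%:E|)%E = 0%E.
  rewrite (eq_integral (fun x : borelType M => (u x)%:E)); last first.
    by move=> x _ /=; rewrite ger0_norm // /u re_mulconj -!expr2 addr_ge0 ?sqr_ge0.
  move: f0; rewrite /dot /= /Rintegral -/u => f0.
  by rewrite -[LHS]fineK ?f0 //; exact: integrable_fin_num.
have [+ _] := ae_eq_integral_abs mu measurableT m1 => /(_ e1).
apply: filterS => x /(_ I) /= [] /eqP; rewrite /u re_mulconj -!expr2 paddr_eq0 ?sqr_ge0 //.
rewrite !sqrf_eq0 => /andP[/eqP a /eqP b].
by apply/eqP; rewrite eq_complex; apply/andP; split; apply/eqP.
Qed.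

Lemma L2norm_aeq f g : inL2 f -> inL2 g -> aeq f g -> L2norm f = L2norm g.
Proof.
move=> Lf Lg fg; rewrite /L2norm /dot /= /Rintegral; congr (Num.sqrt (fine _)).
have [m1 _] := integrableP _ _ _ (integrable_re Lf Lf).
have [m2 _] := integrableP _ _ _ (integrable_re Lg Lg).
apply: ae_eq_integral => //.
by move: fg; apply: aeS => x fgx _ /=; rewrite /re_part fgx.
Qed.
End L2.

(** * Inequalities for the L^2 norm *)

Section PreHilbert.
Variables (R : realType) (n : nat) (M : compact_riemannian_manifold R n).
Local Notation fn := (M -> R[i]).
Implicit Types (f g h : fn) (c : R[i]).

Lemma inL2_0 : inL2 (0 : fn).
Proof.
have h : sq_integrable (fun _ : M => 0 : R).
  split; first exact: measurable_cst.
  by rewrite integral0_eq // => x _; rewrite expr0n.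
exact: sq_integrable_inL2.
Qed.

Lemma inL2Z c f : inL2 f -> inL2 (c *: f).
Proof. by move=> Lf; rewrite -[c *: f]addr0; apply: inL2_lin => //; exact: inL2_0. Qed.

Lemma inL2D f g : inL2 f -> inL2 g -> inL2 (f + g).
Proof. by move=> Lf Lg; rewrite -[f]scale1r; exact: inL2_lin. Qed.

Lemma inL2N f : inL2 f -> inL2 (- f).
Proof. by rewrite -scaleN1r; exact: inL2Z. Qed.

Lemma inL2B f g : inL2 f -> inL2 g -> inL2 (f - g).
Proof. by move=> Lf Lg; apply: inL2D => //; exact: inL2N. Qed.

Lemma inL2_sum (J : Type) (r : seq J) (P : pred J) (F : J -> fn) :
  (forall j, inL2 (F j)) -> inL2 (\sum_(j <- r | P j) F j).
Proof.
by move=> hF; apply: big_ind => //; [exact: inL2_0 | exact: inL2D].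
Qed.

Lemma dot0l f : inL2 f -> dot 0 f = 0.
Proof.
move=> Lf; have := dotDl (-1) Lf Lf Lf.
by rewrite scaleN1r addNr mulN1r addNr.
Qed.

Lemma dotZl c f g : inL2 f -> inL2 g -> dot (c *: f) g = c * dot f g.
Proof.
move=> Lf Lg; have := dotDl c Lf inL2_0 Lg.
by rewrite addr0 dot0l // addr0.
Qed.

Lemma dotD f g h : inL2 f -> inL2 g -> inL2 h -> dot (f + g) h = dot f h + dot g h.
Proof. by move=> Lf Lg Lh; rewrite -{1}[f]scale1r dotDl // mul1r. Qed.

Lemma dotB f g h : inL2 f -> inL2 g -> inL2 h -> dot (f - g) h = dot f h - dot g h.
Proof.
by move=> Lf Lg Lh; rewrite dotD //; [rewrite -scaleN1r dotZl // mulN1r | exact: inL2N].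
Qed.

Lemma dot_suml (J : Type) (r : seq J) (P : pred J) (F : J -> fn) g :
  (forall j, inL2 (F j)) -> inL2 g ->
  dot (\sum_(j <- r | P j) F j) g = \sum_(j <- r | P j) dot (F j) g.
Proof.
move=> hF Lg; elim: r => [|j r IH]; first by rewrite !big_nil dot0l.
rewrite !big_cons; case: ifP => // _.
by rewrite dotD ?IH //; apply: inL2_sum.
Qed.

Lemma dotZr c f g : inL2 f -> inL2 g -> dot f (c *: g) = c^* * dot f g.
Proof.
move=> Lf Lg; rewrite (dotC (inL2Z c Lg) Lf) dotZl // rmorphM.
by congr (_ * _); rewrite [RHS](dotC Lg Lf).
Qed.

Lemma dotDr f g h : inL2 f -> inL2 g -> inL2 h -> dot h (f + g) = dot h f + dot h g.
Proof.
move=> Lf Lg Lh; rewrite (dotC (inL2D Lf Lg) Lh) dotD // rmorphD.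
by congr (_ + _); rewrite [RHS]dotC.
Qed.

Lemma dot_sumr (J : Type) (r : seq J) (P : pred J) (F : J -> fn) g :
  (forall j, inL2 (F j)) -> inL2 g ->
  dot g (\sum_(j <- r | P j) F j) = \sum_(j <- r | P j) dot g (F j).
Proof.
move=> hF Lg; rewrite (dotC (inL2_sum _ _ hF) Lg) dot_suml // rmorph_sum.
by apply: eq_bigr => j _; rewrite [RHS](dotC (hF j) Lg).
Qed.

Lemma re_dot f : complex.Re (dot f f) = L2norm f ^+ 2.
Proof. by rewrite -L2norm_sqr. Qed.

Lemma re_dotC f g : inL2 f -> inL2 g -> complex.Re (dot g f) = complex.Re (dot f g).
Proof. by move=> Lf Lg; rewrite dotC //; case: (dot f g). Qed.

(** As a quadratic polynomial in a real [t] this yields Cauchy-Schwarz; its value at [t = 1] yields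
    the triangle inequality. *)
Lemma L2norm_sqrD (t : R) f g : inL2 f -> inL2 g ->
  L2norm (t%:C%C *: f + g) ^+ 2 =
  t ^+ 2 * L2norm f ^+ 2 + 2 * t * complex.Re (dot f g) + L2norm g ^+ 2.
Proof.
move=> Lf Lg; rewrite -!re_dot; have Lt := inL2Z t%:C%C Lf.
rewrite dotD; [|by []|by []|exact: inL2D].
rewrite !dotDr // !dotZl // !dotZr //.
have := re_dotC Lf Lg.
by case: (dot f f) (dot f g) (dot g f) (dot g g) => [a b] [p q] [p' q'] [u v] /= ->; ring.
Qed.

Lemma cauchy_schwarz f g : inL2 f -> inL2 g ->
  `|complex.Re (dot f g)| <= L2norm f * L2norm g.
Proof.
move=> Lf Lg.
have F0 := L2norm_ge0 f; have G0 := L2norm_ge0 g.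
have := fun t => L2norm_sqrD t Lf Lg.
move: (complex.Re _) => X hX.
have {hX}h t : 0 <= t ^+ 2 * L2norm f ^+ 2 + 2 * t * X + L2norm g ^+ 2.
  by rewrite -hX sqr_ge0.
move: (L2norm f) (L2norm g) F0 G0 h => F G F0 G0 h.
rewrite -ler_sqr ?nnegrE ?mulr_ge0 // real_normK ?num_real //.
(* If [F = 0] the polynomial is affine in [t], and [X] must vanish: the chosen [t] would otherwise
   give it the value [-1]. *)
have [F00|Fn0] := eqVneq F 0.
  have [->|Xn0] := eqVneq X 0; first by rewrite expr0n sqr_ge0.
  have := h (- (G ^+ 2 + 1) / (2 * X)); rewrite F00 expr0n mulr0 add0r.
  by rewrite (_ : 2 * _ * X = - (G ^+ 2 + 1)); [lra | field].
have F2 : 0 < F ^+ 2 by rewrite exprn_even_gt0.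
(* This [t] minimizes the quadratic polynomial. *)
have := h (- X / F ^+ 2).
rewrite (_ : _ + _ = G ^+ 2 - X ^+ 2 / F ^+ 2); last by field.
by rewrite subr_ge0 ler_pdivrMr // exprMn mulrC.
Qed.

Lemma L2norm_triangle f g : inL2 f -> inL2 g -> L2norm (f + g) <= L2norm f + L2norm g.
Proof.
move=> Lf Lg; have F0 := L2norm_ge0 f; have G0 := L2norm_ge0 g.
rewrite -ler_sqr ?nnegrE ?addr_ge0 ?L2norm_ge0 //.
have := L2norm_sqrD 1 Lf Lg; rewrite scale1r => ->.
have := cauchy_schwarz Lf Lg; have := ler_norm (complex.Re (dot f g)).
by move: (complex.Re _) => X; nra.
Qed.

Lemma L2normZ c f : inL2 f -> (L2norm (c *: f) ^+ 2)%:C%C = c * c^* * (L2norm f ^+ 2)%:C%C.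
Proof. by move=> Lf; rewrite !L2norm_sqr dotZl ?dotZr ?mulrA //; exact: inL2Z. Qed.

Lemma L2normN f : inL2 f -> L2norm (- f) = L2norm f.
Proof.
move=> Lf; have := L2normZ (-1) Lf; rewrite scaleN1r rmorphN1 mulrNN !mul1r => -[e].
by apply/eqP; rewrite -(@eqrXn2 _ 2) ?L2norm_ge0 // e.
Qed.

Lemma L2norm0 : L2norm (0 : fn) = 0.
Proof. by rewrite /L2norm dot0l ?sqrtr0 //; exact: inL2_0. Qed.

(** Cauchy-Schwarz bounds real parts; applied to [f] and to ['i *: f] it kills both parts of the
    product. *)
Lemma dot_norm0 f g : inL2 f -> inL2 g -> L2norm f = 0 -> dot f g = 0.
Proof.
move=> Lf Lg f0.
have h c : complex.Re (c * dot f g) = 0.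
  have /eqP : (L2norm (c *: f) ^+ 2)%:C%C = 0 by rewrite L2normZ // f0 expr0n mulr0.
  rewrite eq_complex /= sqrf_eq0 eqxx andbT => /eqP e.
  have := cauchy_schwarz (inL2Z c Lf) Lg.
  by rewrite e mul0r normr_le0 dotZl // => /eqP.
have := h 1; have := h 'i%C; move: (dot f g) => [p q] /=.
by rewrite !mul0r mul1r !mul1r sub0r subr0 => /eqP; rewrite oppr_eq0 => /eqP -> ->.
Qed.
End PreHilbert.

(** * Linearity of the Laplacian *)

Lemma continuous_at_comb (R : realType) (T : topologicalType) (a b : R)
    (f g : T -> R) v : {for v, continuous f} -> {for v, continuous g} ->
  {for v, continuous (fun w => a * f w + b * g w)}.
Proof. by move=> cf cg; apply: cvgD; apply: cvgM => //; exact: cvg_cst. Qed.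

Section Directional.
Variables (R : realType) (V : normedModType R).
Implicit Types (f g : V -> R) (v e : V).

(** Derivability along one direction is weaker than differentiability, so the chain rule cannot be
    used on [V] itself. Restricted to a line, the two notions coincide. *)
Lemma derivable_line f v e :
  derivable f v e <-> derivable (fun t : R => f (t *: e + v)) 0 1.
Proof.
rewrite /derivable.
have -> // : (fun h : R => h^-1 *: ((f \o shift v) (h *: e) - f v)) =
  (fun h : R => h^-1 *: (((fun t => f (t *: e + v)) \o shift 0) (h *: 1) - f (0 *: e + v))).
by apply/funext => h /=; rewrite addr0 scale0r add0r [h *: 1]mulr1.
Qed.

(* Where [f v < 0] the square root is locally zero, so only [f v = 0] is excluded. *)
Lemma derivable_sqrt f v e : f v != 0 -> derivable f v e ->
  derivable (fun w => Num.sqrt (f w)) v e.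
Proof.
move=> fv /derivable_line df; apply/derivable_line => /=.
set F := (fun t : R => f (t *: e + v)) in df *.
have F0 : F 0 = f v by rewrite /F scale0r add0r.
have [f0|f0|f0] := ltgtP (f v) 0; last by rewrite f0 eqxx in fv.
- apply: (@near_eq_derivable _ _ _ (cst 0)); last exact: derivable_cst.
  have /differentiable_continuous cF : differentiable F 0 by exact/derivable1_diffP.
  have : \forall t \near (0 : R), F t < 0 by apply: (cF [set y | y < 0]); rewrite F0; exact: lt_nbhsl.
  by apply: filterS => t Ft /=; rewrite ler0_sqrtr // ltW.
- apply/derivable1_diffP; apply: (@differentiable_comp _ _ _ _ F Num.sqrt).
    exact/derivable1_diffP.
  apply/derivable1_diffP; rewrite F0.
  by have [] := is_derive1_sqrt f0.
Qed.

Lemma derivable_bigsum (J : Type) (r : seq J) (P : pred J) (F : J -> V -> R) v e :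
  (forall j, P j -> derivable (F j) v e) ->
  derivable (fun w => \sum_(j <- r | P j) F j w) v e.
Proof.
move=> hF; elim: r => [|j r IH].
  by under eq_fun do rewrite big_nil; exact: derivable_cst.
under eq_fun do rewrite big_cons.
by case: ifP => [/hF Pj|_]; [exact: derivableD | exact: IH].
Qed.

Lemma derivable_bigprod (J : Type) (r : seq J) (P : pred J) (F : J -> V -> R) v e :
  (forall j, P j -> derivable (F j) v e) ->
  derivable (fun w => \prod_(j <- r | P j) F j w) v e.
Proof.
move=> hF; elim: r => [|j r IH].
  by under eq_fun do rewrite big_nil; exact: derivable_cst.
under eq_fun do rewrite big_cons.
by case: ifP => [/hF Pj|_]; [exact: derivableM | exact: IH].
Qed.

Lemma derivable_det n (G : V -> 'M[R]_n) v e :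
  (forall i j, derivable (fun w => G w i j) v e) ->
  derivable (fun w => \det (G w)) v e.
Proof.
move=> hG; apply: derivable_bigsum => s _; apply: derivableM => //.
exact: derivable_bigprod.
Qed.

(** Cramer's rule makes the entries rational in those of [G]. It describes [invmx] at invertible
    matrices only, hence the open set [U]. *)
Lemma derivable_invmx n (U : set V) (G : V -> 'M[R]_n) v e :
  open U -> U v -> (forall w, U w -> G w \in unitmx) ->
  (forall i j, derivable (fun w => G w i j) v e) ->
  forall i j, derivable (fun w => invmx (G w) i j) v e.
Proof.
move=> oU Uv Gu hG i j.
have h : {near v, (fun w => (\det (G w))^-1 * cofactor (G w) j i) =1
    (fun w => invmx (G w) i j)}.
  have : nbhs v U by apply: open_nbhs_nbhs.
  by apply: filterS => w /Gu Gw; rewrite /invmx Gw !mxE.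
apply: near_eq_derivable h _; apply: derivableM.
  apply: derivableV; last exact: derivable_det.
  by rewrite -unitfE -unitmxE; exact: Gu.
apply: derivableM => //; apply: derivable_det => k l.
by under eq_fun do rewrite !mxE; exact: hG.
Qed.

Lemma derivable_comb (a b : R) f g v e : derivable f v e -> derivable g v e ->
  derivable (fun w => a * f w + b * g w) v e.
Proof. by move=> df dg; apply: derivableD; apply: derivableZ. Qed.

Lemma derive_comb (a b : R) f g v e : derivable f v e -> derivable g v e ->
  'D_e (fun w => a * f w + b * g w) v = a * 'D_e f v + b * 'D_e g v.
Proof.
move=> df dg.
have -> : (fun w => a * f w + b * g w) = (a *: f) + (b *: g) by [].
by rewrite deriveD; [rewrite !deriveZ | exact: derivableZ | exact: derivableZ].
Qed.
End Directional.

Section Smooth.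
Variables (R : realType) (n : nat).
Implicit Types (U : set 'rV[R]_n) (f g : 'rV[R]_n -> R).

(** Needed because [partial] of a combination is the combination of the partials only where the
    derivatives exist, that is, on [U]. *)
Lemma Ck_on_eq k U f g : open U -> (forall v, U v -> f v = g v) ->
  Ck_on k U f -> Ck_on k U g.
Proof.
move=> oU; elim: k f g => [|k IH] f g fg /= hf.
  by move=> v Uv; apply: (continuous_at_eq_on oU Uv fg); exact: hf.
have nfg v : U v -> {near v, f =1 g}.
  move=> Uv; have : nbhs v U by apply: open_nbhs_nbhs.
  by apply: filterS => w /fg.
move=> i; have [df cf] := hf i; split.
  move=> v Uv; apply: near_eq_derivable (nfg v Uv) _; exact: df.
apply: IH cf => v Uv; apply: near_eq_derive; exact: nfg.
Qed.

Lemma Ck_on_comb k U (a b : R) f g : open U -> Ck_on k U f -> Ck_on k U g ->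
  Ck_on k U (fun v => a * f v + b * g v).
Proof.
move=> oU; elim: k f g => [|k IH] f g /= hf hg.
  by move=> v Uv; apply: continuous_at_comb; [exact: hf | exact: hg].
move=> i; have [df cf] := hf i; have [dg cg] := hg i; split.
  by move=> v Uv; apply: derivable_comb; [exact: df | exact: dg].
apply: Ck_on_eq (IH _ _ cf cg) => // v Uv.
by rewrite /partial derive_comb //; [exact: df | exact: dg].
Qed.

Lemma smooth_on_comb U (a b : R) f g : open U -> smooth_on U f -> smooth_on U g ->
  smooth_on U (fun v => a * f v + b * g v).
Proof. by move=> oU hf hg k; exact: Ck_on_comb. Qed.

(** Additivity of ['D_] holds for derivable functions, so the point is that the fluxes [F u i] are
    derivable: this uses the invertibility and smoothness of [G] and the second derivatives of
    [u]. *)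
Lemma beltrami_comb U (G : 'rV[R]_n -> 'M[R]_n) (a b : R) f g v :
  open U -> U v -> (forall w, U w -> G w \in unitmx) ->
  (forall i j, smooth_on U (fun w => G w i j)) ->
  smooth_on U f -> smooth_on U g ->
  beltrami G (fun w => a * f w + b * g w) v =
  a * beltrami G f v + b * beltrami G g v.
Proof.
move=> oU Uv Gu sG sf sg.
pose F u i w := Num.sqrt (\det (G w)) * \sum_(j < n) invmx (G w) i j * partial j u w.
have dG i j e w : U w -> derivable (fun w => G w i j) w (delta_mx 0 e).
  by move=> Uw; have [+ _] := sG i j 1%N e; apply.
have dF u i : smooth_on U u -> derivable (F u i) v (delta_mx 0 i).
  move=> su; apply: derivableM.
    apply: derivable_sqrt; first by rewrite -unitfE -unitmxE; exact: Gu.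
    by apply: derivable_det => j k; exact: dG.
  apply: derivable_bigsum => j _; apply: derivableM.
    by apply: (derivable_invmx oU) => // k l; exact: dG.
  by have [_ /(_ i) [+ _]] := su 2%N j; apply.
rewrite /beltrami !mulrA -!mulrA ![_ * (- _ * _)]mulrCA -mulrDr; congr (_ * _).
rewrite !mulr_sumr -big_split /=; apply: eq_bigr => i _.
rewrite -derive_comb; [|exact: dF|exact: dF].
(* Linearity of the flux is known on [U] only, which is enough since a derivative at [v] depends on
   the germ there. *)
apply: near_eq_derive; have : nbhs v U by apply: open_nbhs_nbhs.
apply: filterS => w Uw; rewrite /F [a * _]mulrCA [b * _]mulrCA -mulrDr; congr (_ * _).
rewrite !mulr_sumr -big_split /=; apply: eq_bigr => j _.
rewrite [a * _]mulrCA [b * _]mulrCA -mulrDr; congr (_ * _).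
have [+ _] := sf 1%N j => /(_ w Uw) df; have [+ _] := sg 1%N j => /(_ w Uw) dg.
exact: derive_comb.
Qed.
End Smooth.

Section Laplacian.
Variables (R : realType) (n : nat) (M : compact_riemannian_manifold R n).
Implicit Types (f g : M -> R[i]) (c : R[i]).

Lemma metric_unit (a : chart_index M) v :
  chart_img (chart_of a) v -> metric_in a v \in unitmx.
Proof.
move=> av; rewrite unitmxE unitfE; apply/det0P => -[u u0 uG].
by have := metric_pos av u0; rewrite uG mul0mx mxE ltxx.
Qed.

(** The factors [1] display a complex combination as two nested real ones, the form to which
    [smooth_on_comb] and [beltrami_comb] apply. *)
Lemma in_chart_re (a : chart_index M) c f g : in_chart a (re_part (c *: f + g)) =
  fun w => 1 * (complex.Re c * in_chart a (re_part f) w +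
   (- complex.Im c) * in_chart a (im_part f) w) + 1 * in_chart a (re_part g) w.
Proof. by apply/funext => w; rewrite /in_chart /= re_partE; ring. Qed.

Lemma in_chart_im (a : chart_index M) c f g : in_chart a (im_part (c *: f + g)) =
  fun w => 1 * (complex.Re c * in_chart a (im_part f) w +
   complex.Im c * in_chart a (re_part f) w) + 1 * in_chart a (im_part g) w.
Proof. by apply/funext => w; rewrite /in_chart /= im_partE; ring. Qed.

Lemma smooth_lin c f g : smooth f -> smooth g -> smooth (c *: f + g).
Proof.
move=> sf sg a; have [fr fi] := sf a; have [gr gi] := sg a.
have oU : open (chart_img (chart_of a)) by exact: chart_img_open.
by rewrite in_chart_re in_chart_im; split; apply: smooth_on_comb => //;
  exact: smooth_on_comb.
Qed.

Lemma laplacian_lin c f g : smooth f -> smooth g ->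
  laplacian (c *: f + g) = c *: laplacian f + laplacian g.
Proof.
move=> sf sg; apply/funext => x.
change (laplacian (c *: f + g) x = c * laplacian f x + laplacian g x).
rewrite /laplacian; set a := chart_at x; set v := chart_map _ x.
have [fr fi] := sf a; have [gr gi] := sg a.
have av : chart_img (chart_of a) v by exists x => //; exact: chart_atP.
have oU : open (chart_img (chart_of a)) by exact: chart_img_open.
have hB := @beltrami_comb R n (chart_img (chart_of a)) (metric_in a).
have {}hB := fun p q u w => hB p q u w v oU av (@metric_unit a) (metric_smooth a).
rewrite in_chart_re in_chart_im !hB //; try by apply: smooth_on_comb.
move: (beltrami _ (in_chart a (re_part f)) v) (beltrami _ (in_chart a (im_part f)) v)
  (beltrami _ (in_chart a (re_part g)) v) (beltrami _ (in_chart a (im_part g)) v) => A B C D.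
case: c {hB} => p q; apply/eqP; rewrite eq_complex /=.
by apply/andP; split; apply/eqP; ring.
Qed.

Lemma eigenspace_lin l c f g : laplace_eigenspace l f -> laplace_eigenspace l g ->
  laplace_eigenspace l (c *: f + g).
Proof.
move=> [sf lf] [sg lg]; split; first exact: smooth_lin.
by rewrite laplacian_lin // lf lg scalerDr !scalerA [c * _]mulrC.
Qed.

End Laplacian.

(** * Expansions along a refinement *)

Section Refinement.
Variables (R : realType) (n : nat) (M : compact_riemannian_manifold R n).
Local Notation fn := (M -> R[i]).
Variables (I : countType) (V : I -> set fn) (hV : is_refinement V).
Variables (lam : I -> R) (lamP : forall a, spectrum M (lam a)).
Hypothesis V_eigen : forall a, V a `<=` laplace_eigenspace (lam a).
Implicit Types (f g : fn) (c : I -> fn) (w : I -> R) (r : seq I).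

Lemma refinement_lin a (z : R[i]) f g : V a f -> V a g -> V a (z *: f + g).
Proof.
have [+ _ _ _] := hV => /(_ a) [m [b ->]] [x ->] [y ->].
exists (fun i => z * x i + y i); rewrite scaler_sumr -big_split /=.
by apply: eq_bigr => i _; rewrite scalerDl scalerA.
Qed.

Lemma refinement0 a : V a 0.
Proof.
have [+ _ _ _] := hV => /(_ a) [m [b ->]]; exists (fun=> 0).
by rewrite big1 // => i _; rewrite scale0r.
Qed.

Lemma refinement_inL2 a f : V a f -> inL2 f.
Proof. by move=> /V_eigen [sf _]; exact: smooth_inL2. Qed.

(** Vanishing off [r] allows the list to be enlarged without changing sums, so that two elements can
    be written over a common list. *)
Definition coords r c := [/\ uniq r, forall j, V j (c j) & forall j, j \notin r -> c j = 0].

(** A spectral multiplier: weight [1] gives the element itself, [lam] its Laplacian, the indicator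
    of [lam j == l] its component for [l], and [sobolev_weight] the function whose L^2 norm is the
    H^s norm. *)
Definition comb w r c : fn := \sum_(j <- r) (w j)%:C%C *: c j.

Lemma coords_widen r r' c : uniq r' -> {subset r <= r'} -> coords r c -> coords r' c.
Proof.
by move=> u' rr' [u Vc c0]; split => // j jr'; apply: c0; apply: contra jr'; exact: rr'.
Qed.

Lemma comb_widen w r r' c : uniq r' -> {subset r <= r'} -> coords r c ->
  comb w r' c = comb w r c.
Proof.
move=> u' rr' [u _ c0]; rewrite /comb.
rewrite (bigID (mem r)) /= [X in _ + X]big1 => [|j jr]; last by rewrite c0 ?scaler0.
rewrite addr0 -big_filter; apply: perm_big; apply: uniq_perm; rewrite ?filter_uniq //.
by move=> j; rewrite mem_filter; case: (boolP (j \in r)) => //= /rr' ->.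
Qed.

Lemma coords_common r r' c c' : coords r c -> coords r' c' -> exists r'',
  [/\ coords r'' c, coords r'' c', forall w, comb w r'' c = comb w r c &
      forall w, comb w r'' c' = comb w r' c'].
Proof.
move=> fc fc'; exists (undup (r ++ r')).
have s1 : {subset r <= undup (r ++ r')} by move=> j jr; rewrite mem_undup mem_cat jr.
have s2 : {subset r' <= undup (r ++ r')} by move=> j jr; rewrite mem_undup mem_cat jr orbT.
have u := undup_uniq (r ++ r').
split; [exact: coords_widen fc | exact: coords_widen fc' | |] => w; exact: comb_widen.
Qed.

Lemma coords_lin (z : R[i]) r c c' : coords r c -> coords r c' ->
  coords r (fun j => z *: c j + c' j).
Proof.
move=> [u Vc c0] [_ Vc' c0']; split => // j; first exact: refinement_lin.
by move=> jr; rewrite c0 // c0' // scaler0 addr0.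
Qed.

Lemma comb_lin (z : R[i]) w r c c' :
  comb w r (fun j => z *: c j + c' j) = z *: comb w r c + comb w r c'.
Proof.
rewrite /comb scaler_sumr -big_split /=; apply: eq_bigr => j _.
by rewrite scalerDr !scalerA [z * _]mulrC.
Qed.

Lemma comb1 r c : comb (fun=> 1) r c = \sum_(j <- r) c j.
Proof. by apply: eq_bigr => j _; rewrite scale1r. Qed.

Lemma comb_inL2 w r c : (forall j, V j (c j)) -> inL2 (comb w r c).
Proof. by move=> Vc; apply: inL2_sum => j; apply: inL2Z; exact: refinement_inL2 (Vc j). Qed.

(** [algsum] allows repeated indices and arbitrary values off its list; adding the terms one by one
    merges the repetitions. *)
Lemma Efin_coords f : @Efin R n M f -> exists r c, coords r c /\ f = comb (fun=> 1) r c.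
Proof.
have [_ _ _ <-] := hV; move=> [r [c [hc ->]]].
elim: r hc => [|j r IH] hc.
  exists [::], (fun=> 0); rewrite /comb !big_nil; split => //.
  by split => // j; exact: refinement0.
have [|r' [c' [[u Vc c0] e]]] := IH; first by move=> i ir; apply: hc; rewrite inE ir orbT.
have [_ Vj] := hc j (mem_head _ _).
pose r'' := undup (j :: r'); pose cj i := if i == j then c j else 0.
have sub : {subset r' <= r''} by move=> i ir; rewrite mem_undup inE ir orbT.
  have fc' : coords r' c' by [].
  have f' := coords_widen (undup_uniq _) sub fc'.
have fj : coords r'' cj.
  split; first exact: undup_uniq.
    by move=> i; rewrite /cj; case: eqP => [->|_] //; exact: refinement0.
  by move=> i; rewrite /cj mem_undup inE; case: eqP.
exists r'', (fun i => 1 *: cj i + c' i); split; first exact: coords_lin.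
rewrite comb_lin scale1r big_cons e (comb_widen _ (undup_uniq _) sub fc').
congr (_ + _); rewrite comb1 (bigD1_seq j) /= ?undup_uniq ?mem_undup ?mem_head //.
by rewrite /cj eqxx big1 ?addr0 // => i /negbTE ->.
Qed.

Lemma dot_comb w w' r c c' : coords r c -> coords r c' ->
  dot (comb w r c) (comb w' r c') = \sum_(j <- r) (w j * w' j)%:C%C * dot (c j) (c' j).
Proof.
move=> [u Vc _] [_ Vc' _].
have L j : inL2 (c j) by exact: refinement_inL2 (Vc j).
have L' j : inL2 (c' j) by exact: refinement_inL2 (Vc' j).
rewrite dot_suml; [|by move=> j; exact: inL2Z|exact: comb_inL2].
rewrite !big_seq; apply: eq_bigr => j jr.
rewrite dot_sumr; [|by move=> k; exact: inL2Z|exact: inL2Z].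
rewrite (bigD1_seq j) //= big1 ?addr0 => [|k kj].
  rewrite dotZl ?dotZr //; last exact: inL2Z.
  rewrite mulrA rmorphM; congr (_ * _ * _).
  by apply/eqP; rewrite eq_complex /= oppr0 !eqxx.
rewrite dotZl ?dotZr //; last exact: inL2Z.
have [_ _ orth _] := hV.
by rewrite (orth j k) ?mulr0 // eq_sym.
Qed.

Lemma L2norm_comb w r c : coords r c ->
  L2norm (comb w r c) ^+ 2 = \sum_(j <- r) w j ^+ 2 * L2norm (c j) ^+ 2.
Proof.
move=> fc; apply: complexI; rewrite L2norm_sqr dot_comb // rmorph_sum.
by apply: eq_bigr => j _; rewrite -[dot _ _]L2norm_sqr -rmorphM expr2.
Qed.

(** Membership in the spectrum supplies an eigenfunction [f], and [0] is [- f + f]. *)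
Lemma eigenspace0 l : spectrum M l -> laplace_eigenspace l (0 : fn).
Proof.
by move=> [_ [f Ef _]]; have := eigenspace_lin (-1) Ef Ef; rewrite scaleN1r addNr.
Qed.

Lemma laplacian_comb r c : smooth (0 : fn) -> laplacian (0 : fn) = 0 ->
  (forall j, V j (c j)) ->
  smooth (comb (fun=> 1) r c) /\ laplacian (comb (fun=> 1) r c) = comb lam r c.
Proof.
move=> s0 l0 Vc; rewrite /comb; elim: r => [|j r [sr lr]]; first by rewrite !big_nil.
have [sj lj] := V_eigen (Vc j).
rewrite !big_cons; split; first exact: smooth_lin.
by rewrite laplacian_lin // lj lr scale1r.
Qed.

(* Applying the Laplacian to the expansion of an eigenfunction and using that
   the expansion is orthogonal isolates the terms with the right eigenvalue. *)
Lemma eigen_component l r c j : laplace_eigenspace l (comb (fun=> 1) r c) ->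
  spectrum M l -> coords r c -> lam j != l -> L2norm (c j) = 0.
Proof.
move=> [sf lf] sl fc jl; have [u Vc c0] := fc.
have [s0 l0] := eigenspace0 sl.
have [_ lc] := laplacian_comb r s0 (etrans l0 (scaler0 _ _)) Vc.
have e : comb (fun j => lam j - l) r c = 0.
  have -> : comb (fun j => lam j - l) r c = comb lam r c - l%:C%C *: comb (fun=> 1) r c.
    rewrite /comb scaler_sumr -sumrB; apply: eq_bigr => i _.
    by rewrite scale1r -scalerBl rmorphB.
  by rewrite -lc lf subrr.
have [jr|/c0 ->] := boolP (j \in r); last exact: L2norm0.
have /esym/eqP := L2norm_comb (fun j => lam j - l) fc.
rewrite e L2norm0 expr0n psumr_eq0; last by move=> i _; rewrite mulr_ge0 ?sqr_ge0.
move=> /allP /(_ j jr) /=; rewrite mulf_eq0 !sqrf_eq0 subr_eq0 (negbTE jl) /=.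
by move/eqP.
Qed.

Lemma eigenspace_Efin l f : spectrum M l -> laplace_eigenspace l f -> @Efin R n M f.
Proof.
move=> sl lf; exists [:: l], (fun=> f); rewrite big_seq1; split => // j.
by rewrite inE => /eqP ->.
Qed.

(** Keeping the terms of eigenvalue [l] gives an explicit projection [h0]; the one chosen by [proj]
    is then compared with it in norm. *)
Lemma proj_norm l r c : spectrum M l -> coords r c ->
  L2norm (Defs.proj (laplace_eigenspace l) (comb (fun=> 1) r c)) ^+ 2 =
  \sum_(j <- r | lam j == l) L2norm (c j) ^+ 2.
Proof.
move=> sl fc; set f := comb _ r c; have [u Vc c0] := fc.
pose d j : R := (lam j == l)%:R; pose h0 := comb d r c.
have Lf : inL2 f by exact: comb_inL2.
have Lh0 : inL2 h0 by exact: comb_inL2.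
have EL2 (k : fn) : laplace_eigenspace l k -> inL2 k by case=> sk _; exact: smooth_inL2.
have Eh0 : laplace_eigenspace l h0.
  rewrite /h0 /comb; elim: (r) => [|j s IH]; first by rewrite big_nil; exact: eigenspace0.
  rewrite big_cons /d; case: eqP => [e|_]; last by rewrite scale0r add0r.
  by apply: eigenspace_lin IH; rewrite -e; apply: V_eigen.
have hd : f - h0 = comb (fun j => 1 - d j) r c.
  by rewrite /f /h0 /comb -sumrB; apply: eq_bigr => j _; rewrite -scalerBl rmorphB.
(* Expand [k] along the [V j]: where [lam j = l] the weight [1 - d j] is zero, elsewhere the
   coordinate of [k] is null by [eigen_component]. *)
have P0 k : laplace_eigenspace l k -> dot (f - h0) k = 0.
  move=> Ek; have [r' [c' [fc' ek]]] := Efin_coords (eigenspace_Efin sl Ek).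
  have [s [f1 f2 e1 e2]] := coords_common fc fc'.
  rewrite hd -e1 ek -e2 dot_comb // big1 // => j _.
  have [lj|lj] := eqVneq (lam j) l; first by rewrite /d lj eqxx subrr mul0r mul0r.
  have cj0 : L2norm (c' j) = 0.
    by apply: (@eigen_component l s) => //; rewrite e2 -ek.
  have Lc : inL2 (c j) by exact: refinement_inL2 (Vc j).
  have Lc' : inL2 (c' j) by case: fc' => _ Vc' _; exact: refinement_inL2 (Vc' j).
  by rewrite (dotC Lc' Lc) dot_norm0 // rmorph0 mulr0.
set h := Defs.proj _ _.
have [Eh P1] : laplace_eigenspace l h /\
    forall k, laplace_eigenspace l k -> dot (f - h) k = 0.
  by apply: (@xgetPex _ 0 [set h | _ h /\ _]); exists h0.
have Lh := EL2 _ Eh.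
have Ed : laplace_eigenspace l (h - h0).
  by rewrite addrC -scaleN1r; exact: eigenspace_lin.
have Ld := EL2 _ Ed.
have d0 k : laplace_eigenspace l k -> dot (h - h0) k = 0.
  move=> Ek; have Lk := EL2 _ Ek.
  have -> : h - h0 = (f - h0) - (f - h) by rewrite opprB [RHS]addrC subrKA.
  by rewrite dotB ?P0 ?P1 ?subr0 //; exact: inL2B.
(* [h - h0] is orthogonal to the eigenspace, which contains [h] and [h0], so each factor of
   [dot h h] may be replaced by [h0]. *)
have -> : L2norm h ^+ 2 = L2norm h0 ^+ 2.
  apply: complexI; rewrite !L2norm_sqr.
  have -> : dot h h = dot h0 h by apply/eqP; rewrite -subr_eq0 -dotB // d0.
  rewrite (dotC Lh Lh0) (dotC Lh0 Lh0); congr (_^*).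
  by apply/eqP; rewrite -subr_eq0 -dotB // d0.
rewrite L2norm_comb // [RHS]big_mkcond; apply: eq_bigr => j _.
by rewrite /d; case: ifP => _; rewrite ?expr1n ?mul1r // expr0n mul0r.
Qed.

Variable s : R.

Definition sobolev_weight j : R := Num.sqrt ((1 + lam j) `^ s).

(** The sum over the spectrum has nonnegative terms and is exchanged with the finite sum over [r];
    the index [j] then contributes at the single eigenvalue [lam j]. *)
Lemma Efin_norm_comb r c : coords r c ->
  Efin_norm s (comb (fun=> 1) r c) = L2norm (comb sobolev_weight r c).
Proof.
move=> fc; rewrite /Efin_norm.
have -> : \esum_(l in spectrum M)
    ((1 + l) `^ s * L2norm (Defs.proj (laplace_eigenspace l) (comb (fun=> 1) r c)) ^+ 2)%:E =
  \esum_(l in spectrum M) \sum_(j <- r)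
     (if lam j == l then (1 + lam j) `^ s * L2norm (c j) ^+ 2 else 0)%:E.
  apply: eq_esum => l sl; rewrite proj_norm // mulr_sumr big_mkcond -sumEFin.
  by apply: eq_bigr => j _; case: eqP => // ->.
rewrite esum_sum; last first.
  move=> l j _ _; case: ifP => _; rewrite lee_fin //.
  by apply: mulr_ge0; [exact: powR_ge0 | exact: sqr_ge0].
have -> : (\sum_(j <- r) \esum_(l in spectrum M)
    (if lam j == l then (1 + lam j) `^ s * L2norm (c j) ^+ 2 else 0)%:E)%E =
    (L2norm (comb sobolev_weight r c) ^+ 2)%:E.
  rewrite L2norm_comb // -sumEFin; apply: eq_bigr => j _.
  rewrite [sobolev_weight _ ^+ 2]sqr_sqrtr ?powR_ge0 //.
  rewrite (_ : \esum_(l in _) _ = \esum_(l in spectrum M) if l \in [set lam j] then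
     ((1 + lam j) `^ s * L2norm (c j) ^+ 2)%:E else 0%E); last first.
    apply: eq_esum => l _; case: eqP => [->|ne]; first by rewrite ifT // mem_set.
    by rewrite memNset // => /esym.
  rewrite -esum_mkcondr setIidr; last by move=> _ ->; exact: lamP.
  rewrite esum_set1 // lee_fin.
  by apply: mulr_ge0; [exact: powR_ge0 | exact: sqr_ge0].
by rewrite /= sqrtr_sqr ger0_norm // L2norm_ge0.
Qed.
End Refinement.

(** * The Sobolev norm *)

Lemma cvgn_dist (R : realType) (u : nat -> R) (l : R) :
  u @ \oo --> l <->
  forall e, 0 < e -> exists N : nat, forall k, (N <= k)%N -> `|l - u k| < e.
Proof.
split => [/cvgrPdist_lt h e e0|h].
  by have [N _ hN] := h e e0; exists N => k Nk; exact: hN.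
by apply/cvgrPdist_lt => e e0; have [N hN] := h e e0; exists N.
Qed.

Section Sobolev.
Variables (R : realType) (n : nat) (M : compact_riemannian_manifold R n).
Local Notation fn := (M -> R[i]).
Variables (I : countType) (V : I -> set fn) (hV : is_refinement V).
Variables (lam : I -> R) (lamP : forall a, spectrum M (lam a)).
Hypothesis V_eigen : forall a, V a `<=` laplace_eigenspace (lam a).
Variables (s : R) (s_ge0 : 0 <= s).
Implicit Types (f g u : fn) (e : nat -> fn).

Let EF := Efin_coords hV.
Local Notation Efin := (@Efin R n M).
Local Notation W := (sobolev_weight lam s).
Let EN r c (h : coords V r c) : Efin_norm s (comb (fun=> 1) r c) = L2norm (comb W r c) :=
  Efin_norm_comb hV lamP V_eigen s h.

Lemma Efin_comb r c : coords V r c -> Efin (comb (fun=> 1) r c).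
Proof.
move=> [u Vc c0]; have [_ _ _ <-] := hV; rewrite comb1.
by exists r, c; split.
Qed.

Lemma Efin_lin (z : R[i]) f g : Efin f -> Efin g -> Efin (z *: f + g).
Proof.
move=> /EF [r [c [fc ->]]] /EF [r' [c' [fc' ->]]].
have [r'' [f1 f2 <- <-]] := coords_common fc fc'.
by rewrite -comb_lin; apply: Efin_comb; exact: coords_lin.
Qed.

Lemma EfinB f g : Efin f -> Efin g -> Efin (f - g).
Proof. by move=> Ef Eg; rewrite addrC -scaleN1r; exact: Efin_lin. Qed.

Lemma Efin_inL2 f : Efin f -> inL2 f.
Proof.
by move=> /EF [r [c [[_ Vc _] ->]]]; exact: comb_inL2.
Qed.

Lemma Efin_norm_triangle f g : Efin f -> Efin g ->
  Efin_norm s (f + g) <= Efin_norm s f + Efin_norm s g.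
Proof.
move=> /EF [r [c [fc ->]]] /EF [r' [c' [fc' ->]]].
have [r'' [f1 f2 <- <-]] := coords_common fc fc'.
rewrite -[comb _ r'' c]scale1r -comb_lin (EN (coords_lin hV 1 f1 f2)).
rewrite scale1r (EN f1) (EN f2) comb_lin scale1r.
by apply: L2norm_triangle; [case: f1 => _ + _ | case: f2 => _ + _]; exact: comb_inL2.
Qed.

Lemma Efin_norm_distC f g : Efin f -> Efin g -> Efin_norm s (f - g) = Efin_norm s (g - f).
Proof.
move=> Ef Eg; rewrite -[f - g]opprB.
have /EF [r [c [fc e]]] := EfinB Eg Ef; rewrite e.
have f0 : coords V r (fun=> 0) by case: fc => u _ _; split => // j; exact: refinement0.
have c0 w : comb w r (fun=> 0 : fn) = 0 by rewrite /comb big1 // => j _; rewrite scaler0.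
have -> : - comb (fun=> 1) r c = comb (fun=> 1) r (fun j => -1 *: c j + 0).
  by rewrite comb_lin c0 addr0 scaleN1r.
rewrite (EN fc) (EN (coords_lin hV (-1) fc f0)).
rewrite comb_lin c0 addr0 scaleN1r L2normN //.
by case: fc => _ + _; exact: comb_inL2.
Qed.

Lemma Efin_norm_ge0 f : 0 <= Efin_norm s f. Proof. exact: sqrtr_ge0. Qed.

Lemma Efin_norm_dist f g : Efin f -> Efin g ->
  `|Efin_norm s f - Efin_norm s g| <= Efin_norm s (f - g).
Proof.
move=> Ef Eg; rewrite ler_norml; apply/andP; split.
  rewrite lerNl opprB lerBlDr (Efin_norm_distC Ef Eg).
  by have := Efin_norm_triangle (EfinB Eg Ef) Ef; rewrite subrK.
by rewrite lerBlDr; have := Efin_norm_triangle (EfinB Ef Eg) Eg; rewrite subrK.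
Qed.

Lemma L2norm_le_Efin_norm f : Efin f -> L2norm f <= Efin_norm s f.
Proof.
move=> /EF [r [c [fc ->]]]; rewrite (EN fc) -ler_sqr ?nnegrE ?L2norm_ge0 //.
rewrite (L2norm_comb hV V_eigen (fun=> 1) fc) (L2norm_comb hV V_eigen W fc); apply: ler_sum => j _.
rewrite expr1n mul1r ler_peMl ?sqr_ge0 // sqr_sqrtr ?powR_ge0 //.
have [l0 _] := lamP j; have l1 : 1 <= 1 + lam j by rewrite lerDl.
by have := ler_powR l1 s_ge0; rewrite powRr0.
Qed.

(* [A] is [f] with its components scaled by [(1 + lam) ^ s]: then the H^s scalar
   product of [f] and [u] is the L^2 scalar product of [A] and [u]. *)
Lemma Efin_norm_dual f : Efin f -> exists2 A : fn, inL2 A & forall u, Efin u ->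
  Efin_norm s f ^+ 2 <= Efin_norm s f * Efin_norm s (f - u) + L2norm A * L2norm u.
Proof.
move=> /EF [r [c [fc ->]]].
exists (comb (fun j => W j * W j) r c); first by case: fc => _ + _; exact: comb_inL2.
move=> u /EF [r' [c' [fc' ->]]].
have [r'' [f1 f2 e1 e2]] := coords_common fc fc'; rewrite -!e1 -!e2 {fc fc' e1 e2}.
have L1 w : inL2 (comb w r'' c) by case: f1 => _ + _; exact: comb_inL2.
have L2 w : inL2 (comb w r'' c') by case: f2 => _ + _; exact: comb_inL2.
have eB w : comb w r'' c - comb w r'' c' = comb w r'' (fun j => -1 *: c' j + c j).
  by rewrite comb_lin scaleN1r addrC.
rewrite eB (EN f1) (EN (coords_lin hV (-1) f2 f1)).
rewrite -eB -re_dot.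
have -> : dot (comb W r'' c) (comb W r'' c) =
    dot (comb W r'' c) (comb W r'' c - comb W r'' c') +
    dot (comb (fun j => W j * W j) r'' c) (comb (fun=> 1) r'' c').
  have -> : dot (comb (fun j => W j * W j) r'' c) (comb (fun=> 1) r'' c') =
      dot (comb W r'' c) (comb W r'' c').
    rewrite (dot_comb hV V_eigen _ _ f1 f2) (dot_comb hV V_eigen W W f1 f2).
    by apply: eq_bigr => j _; rewrite mulr1.
  by rewrite -dotDr ?subrK //; exact: inL2B.
have C1 := cauchy_schwarz (L1 W) (inL2B (L1 W) (L2 W)).
have C2 := cauchy_schwarz (L1 (fun j => W j * W j)) (L2 (fun=> 1)).
rewrite (_ : complex.Re (_ + _) = complex.Re (dot (comb W r'' c) (comb W r'' c - comb W r'' c'))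
  + complex.Re (dot (comb (fun j => W j * W j) r'' c) (comb (fun=> 1) r'' c'))); last first.
  by case: (dot _ _) (dot _ _) => [? ?] [? ?].
by apply: lerD; [exact: le_trans (ler_norm _) C1 | exact: le_trans (ler_norm _) C2].
Qed.

Definition Efin_cauchy e := forall eps : R, 0 < eps -> exists N : nat,
  forall j k : nat, (N <= j)%N -> (N <= k)%N -> Efin_norm s (e j - e k) < eps.

(** Apply [Efin_norm_dual] to [e j] and [u = e k] with [j] fixed: the first term is small by the
    Cauchy property, the second tends to [0] with [k] because [A] depends on [j] alone. *)
Lemma Efin_norm_closable e : (forall k, Efin (e k)) -> Efin_cauchy e ->
  (fun k => L2norm (e k)) @ \oo --> (0 : R) ->
  (fun k => Efin_norm s (e k)) @ \oo --> (0 : R).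
Proof.
move=> Ee ce le; apply/cvgn_dist => eps eps0.
have [N hN] := ce _ (divr_gt0 eps0 (ltr0Sn R 1)); exists N => j Nj.
rewrite sub0r normrN ger0_norm ?Efin_norm_ge0 //.
have [A LA hA] := Efin_norm_dual (Ee j).
set x := Efin_norm s (e j); have x0 : 0 <= x := Efin_norm_ge0 _.
(* The slack [d] absorbs the dual term; the [+ 1] below keeps the divisor positive when [A] has norm
   [0]. *)
have : x ^+ 2 <= x * (eps / 2).
  apply/ler_addgt0Pr => d d0.
  have A0 : 0 < L2norm A + 1 by rewrite ltr_wpDl ?L2norm_ge0.
  have [K hK] := (cvgn_dist _ _).1 le _ (divr_gt0 d0 A0).
  have := hK (maxn N K) (leq_maxr _ _); rewrite sub0r normrN ger0_norm ?L2norm_ge0 //.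
  rewrite ltr_pdivlMr // => hu.
  apply: le_trans (hA _ (Ee (maxn N K))) _; apply: lerD.
    by apply: ler_wpM2l => //; apply: ltW; apply: hN => //; exact: leq_maxl.
  by apply: le_trans (ltW hu); rewrite mulrC ler_wpM2l ?L2norm_ge0 // lerDl.
rewrite expr2 => xx; apply: (@le_lt_trans _ _ (eps / 2)); last by rewrite ltr_pdivrMr // ltr_pMr // ltr1n.
have [->|xn0] := eqVneq x 0; first by rewrite ltW // divr_gt0.
by move: xx; rewrite ler_pM2l // lt_def xn0.
Qed.

Lemma Hs_approx_cvg f e : Hs_approx s f e ->
  exists l, (fun k => Efin_norm s (e k)) @ \oo --> (l : R).
Proof.
move=> [Ee ce _ _].
suff /cvg_ex [l hl] : cvgn (fun k => Efin_norm s (e k)) by exists l.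
apply: cauchy_cvg; apply: cauchy_exP => eps eps0.
have [N hN] := ce _ eps0; exists (Efin_norm s (e N)); exists N => // k /= Nk.
by apply: le_lt_trans (hN _ _ (leqnn N) Nk); exact: Efin_norm_dist.
Qed.

Lemma Hs_approxB f g e e' : Hs_approx s f e -> Hs_approx s g e' ->
  Hs_approx s (f - g) (fun k => e k - e' k).
Proof.
move=> [Ee ce Lf le] [Ee' ce' Lg le']; split.
- by move=> k; exact: EfinB.
- move=> eps eps0; have e2 := divr_gt0 eps0 (ltr0Sn R 1).
  have [N hN] := ce _ e2; have [N' hN'] := ce' _ e2; exists (maxn N N') => j k.
  rewrite !geq_max => /andP[a1 a2] /andP[b1 b2].
  have -> : e j - e' j - (e k - e' k) = (e j - e k) + (e' k - e' j).
    by rewrite opprB [LHS](AC (2*2) ((1*4)*(3*2))).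
  apply: le_lt_trans (Efin_norm_triangle (EfinB (Ee _) (Ee _)) (EfinB (Ee' _) (Ee' _))) _.
  by rewrite [ltRHS]splitr; apply: ltrD; [exact: hN | exact: hN'].
- exact: inL2B.
apply/cvgn_dist => eps eps0; have e2 := divr_gt0 eps0 (ltr0Sn R 1).
have [N hN] := (cvgn_dist _ _).1 le _ e2; have [N' hN'] := (cvgn_dist _ _).1 le' _ e2.
exists (maxn N N') => k; rewrite geq_max => /andP[a1 a2].
have := hN k a1; have := hN' k a2; rewrite !sub0r !normrN !ger0_norm ?L2norm_ge0 // => h1 h2.
have -> : f - g - (e k - e' k) = (f - e k) + - (g - e' k).
  by rewrite !opprB [LHS](AC (2*2) ((1*4)*(3*2))).
apply: le_lt_trans (L2norm_triangle _ _) _.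
- by apply: inL2B => //; exact: Efin_inL2.
- by apply: inL2N; apply: inL2B => //; exact: Efin_inL2.
rewrite L2normN; last by apply: inL2B => //; exact: Efin_inL2.
by rewrite [ltRHS]splitr; exact: ltrD.
Qed.

(** [Hs_norm] is the limit along some unknown sequence [e']. The difference [e - e'] is H^s-Cauchy
    and tends to [0] in L^2, so closability identifies the two limits. *)
Lemma Hs_norm_cvg f e : Hs_approx s f e ->
  (fun k => Efin_norm s (e k)) @ \oo --> Hs_norm s f.
Proof.
move=> ae; have [l hl] := Hs_approx_cvg ae.
have [e' ae' hr] : exists2 e', Hs_approx s f e' &
    (fun k => Efin_norm s (e' k)) @ \oo --> Hs_norm s f.
  apply: (@xgetPex R 0 [set r | exists2 e, Hs_approx s f e &
    (fun k => Efin_norm s (e k)) @ \oo --> r]).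
  by exists l; exists e.
have [Ed cd _ ld] := Hs_approxB ae ae'.
have [Ee _ _ _] := ae; have [Ee' _ _ _] := ae'.
have d0 : (fun k => Efin_norm s (e k - e' k)) @ \oo --> (0 : R).
  apply: Efin_norm_closable => //; apply: cvg_trans ld; apply: near_eq_cvg.
  apply: nearW => k; rewrite subrr sub0r L2normN //.
  exact: Efin_inL2.
have z : (fun k => Efin_norm s (e k) - Efin_norm s (e' k)) @ \oo --> (0 : R).
  apply/cvgn_dist => eps eps0; have [N hN] := (cvgn_dist _ _).1 d0 _ eps0.
  exists N => k Nk; have := hN k Nk; rewrite !sub0r !normrN.
  apply: le_lt_trans; rewrite [leRHS]ger0_norm ?Efin_norm_ge0 //.
  exact: Efin_norm_dist.
rewrite -[Hs_norm s f]add0r.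
have -> : (fun k => Efin_norm s (e k)) =
    (fun k => Efin_norm s (e k) - Efin_norm s (e' k) + Efin_norm s (e' k)).
  by apply/funext => k; rewrite subrK.
exact: cvgD z hr.
Qed.

Lemma Efin_Hs_approx f : Efin f -> Hs_approx s f (fun=> f).
Proof.
move=> Ef; have Lf := Efin_inL2 Ef.
have z : Efin_norm s (0 : fn) = 0.
  have f0 : coords V [::] (fun=> 0) by split => // j; exact: refinement0.
  by have := EN f0; rewrite /comb !big_nil L2norm0.
split => //.
  by move=> eps eps0; exists 0%N => j k _ _; rewrite subrr z.
by rewrite subrr L2norm0; exact: cvg_cst.
Qed.

Lemma Efin_Hs f : Efin f -> Hs s f.
Proof. by move=> /Efin_Hs_approx; exists (fun=> f). Qed.

Lemma Hs_inL2 f : Hs s f -> inL2 f.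
Proof. by move=> [e []]. Qed.

Lemma HsB f g : Hs s f -> Hs s g -> Hs s (f - g).
Proof. by move=> [e ae] [e' ae']; exists (fun k => e k - e' k); exact: Hs_approxB. Qed.

Lemma Hs_norm_Efin f : Efin f -> Hs_norm s f = Efin_norm s f.
Proof.
move=> /Efin_Hs_approx /Hs_norm_cvg h; apply: (cvg_unique _ h) => //.
exact: cvg_cst.
Qed.

(** This is the density of [Efin]: [f - e k] is approximated by the differences [e j - e k], whose
    norms are small for large [j] and [k]. *)
Lemma Hs_norm_tail f e : Hs_approx s f e ->
  (fun k => Hs_norm s (f - e k)) @ \oo --> (0 : R).
Proof.
move=> ae; have [Ee ce _ _] := ae; apply/cvgn_dist => eps eps0.
have [N hN] := ce _ (divr_gt0 eps0 (ltr0Sn R 1)); exists N => k Nk.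
have h := Hs_norm_cvg (Hs_approxB ae (Efin_Hs_approx (Ee k))).
have h0 : 0 <= Hs_norm s (f - e k).
  rewrite -(cvg_lim _ h) //; apply: limr_ge; first by apply/cvg_ex; eexists; exact: h.
  by apply: nearW => j; exact: Efin_norm_ge0.
rewrite sub0r normrN ger0_norm //.
apply: (@le_lt_trans _ _ (eps / 2)); last by rewrite ltr_pdivrMr // ltr_pMr // ltr1n.
rewrite -(cvg_lim _ h) //; apply: limr_le; first by apply/cvg_ex; eexists; exact: h.
by exists N => // j Nj; apply: ltW; exact: hN.
Qed.

(** Pass to the limit in [L2norm (f - e k) + Efin_norm s (e k)], which bounds [L2norm f] for every
    [k]. *)
Lemma L2norm_le_Hs_norm f : Hs s f -> L2norm f <= Hs_norm s f.
Proof.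
move=> [e ae]; have [Ee _ Lf le] := ae.
have h : (fun k => L2norm (f - e k) + Efin_norm s (e k)) @ \oo --> Hs_norm s f.
  by rewrite -[Hs_norm s f]add0r; apply: cvgD; [exact: le | exact: Hs_norm_cvg].
rewrite -(cvg_lim _ h) //; apply: limr_ge; first by apply/cvg_ex; eexists; exact: h.
apply: nearW => k; have Lk := Efin_inL2 (Ee k).
rewrite -[X in L2norm X <= _](subrK (e k) f).
apply: le_trans (L2norm_triangle (inL2B Lf Lk) Lk) _.
by rewrite lerD2l; exact: L2norm_le_Efin_norm.
Qed.
End Sobolev.

(** * Twisted products *)

Lemma fsum_setT (K : zmodType) (J : choiceType) (r : seq J) (F : J -> K) :
  uniq r -> (forall j, j \notin r -> F j = 0) ->
  \sum_(j \in [set: J]) F j = \sum_(j <- r) F j.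
Proof.
move=> u h; rewrite (@fsbigE _ _ _ _ _ r _ u) //; last by move=> j _; exact: h.
by apply: eq_bigl => j; rewrite in_setT.
Qed.

Lemma cvg_bilinear_bound (R : realType) (C F G : R) (u v p q : nat -> R) :
  u @ \oo --> (0 : R) -> v @ \oo --> (0 : R) -> p @ \oo --> F -> q @ \oo --> G ->
  (fun k => C * u k * G + C * p k * v k + (C * v k * F + C * q k * u k)) @ \oo --> (0 : R).
Proof.
move=> cu cv cp cq.
have cM w l : w @ \oo --> l -> (fun k => C * w k) @ \oo --> C * l.
  by move=> cw; apply: cvgM => //; exact: cvg_cst.
rewrite (_ : 0 = C * 0 * G + C * F * 0 + (C * 0 * F + C * G * 0)); last by rewrite !(mulr0, mul0r, addr0).
apply: cvgD; apply: cvgD; apply: cvgM; try exact: cvg_cst; try exact: cM; done.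
Qed.

Lemma generated_subgroupS (G : zmodType) (S : set G) p : S p -> generated_subgroup S p.
Proof. by move=> Sp H _; apply. Qed.

Section Aeq.
Variables (R : realType) (n : nat) (M : compact_riemannian_manifold R n).
Implicit Types (f g h : M -> R[i]).

Lemma aeq_refl f : aeq f f.
Proof. by apply: (@aeS _ _ M (fun=> True)) => //; exact: (@filterT _ _ (ae_filter_ringOfSetsType (vol M))). Qed.

Lemma aeq_sym f g : aeq f g -> aeq g f.
Proof. exact: aeS. Qed.

Lemma aeq_trans f g h : aeq f g -> aeq g h -> aeq f h.
Proof. by move=> fg gh; apply: aeS (aeI fg gh) => x [-> ->]. Qed.

Lemma aeqD f g f' g' : aeq f f' -> aeq g g' -> aeq (f + g) (f' + g').
Proof.
move=> ff gg; apply: aeS (aeI ff gg) => x [e1 e2].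
by change (f x + g x = f' x + g' x); rewrite e1 e2.
Qed.

Lemma aeq_sum (J : Type) (r : seq J) (F F' : J -> M -> R[i]) :
  (forall j, aeq (F j) (F' j)) -> aeq (\sum_(j <- r) F j) (\sum_(j <- r) F' j).
Proof.
move=> h; elim: r => [|j r IH]; first by rewrite !big_nil; exact: aeq_refl.
by rewrite !big_cons; exact: aeqD.
Qed.

Lemma aeq0_scalel (a : R[i]) f g : aeq f 0 -> aeq (a *: (f \* g)) 0.
Proof.
apply: aeS => x e; change (a * (f x * g x) = 0).
by rewrite e mul0r mulr0.
Qed.

Lemma aeq0_scaler (a : R[i]) f g : aeq g 0 -> aeq (a *: (f \* g)) 0.
Proof.
apply: aeS => x e; change (a * (f x * g x) = 0).
by rewrite e !mulr0.
Qed.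

Lemma aeq_subr0 f g : aeq (f - g) 0 -> aeq f g.
Proof. by apply: aeS => x e; apply/subr0_eq. Qed.
End Aeq.

Section Star.
Variables (R : realType) (n : nat) (M : compact_riemannian_manifold R n).
Local Notation fn := (M -> R[i]).
Variables (s : R) (I : countType) (V : I -> set fn) (G : zmodType) (d : I -> G).
Implicit Types (f g : fn).

(** With no index of degree [p], the algebraic sum contains only the empty sum, so [f] is an L^2
    limit of zeros. *)
Lemma L2_deg_empty p f : (forall a, d a <> p) -> L2_deg V d p f -> aeq f 0.
Proof.
move=> dp [Lf h]; apply: L2norm_eq0 => //; apply/le_anti.
rewrite L2norm_ge0 andbT; apply/ler_addgt0Pr => e e0; rewrite add0r.
have [k [r [c [hc ->]]] he] := h e e0; apply: ltW.
case: r hc he => [|j r] hc; first by rewrite big_nil subr0.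
by have [/dp] := hc j (mem_head _ _).
Qed.

Lemma hcompP f : Hs_graded_fin V d s f ->
  homogeneous_decomposition V d s f (hcomp V d s f).
Proof. by move=> h; apply: (@xgetPex _ (fun=> 0) [set c | homogeneous_decomposition V d s f c]). Qed.

Lemma hcomp_out f p : Hs_graded_fin V d s f -> (forall a, d a <> p) ->
  aeq (hcomp V d s f p) 0.
Proof. by move=> /hcompP [+ _ _] dp => /(_ p) [_]; exact: L2_deg_empty. Qed.

Lemma star_comm (sigma : G -> G -> R[i]) f g :
  (forall p q, range d p -> range d q -> sigma p q = sigma q p) ->
  Hs_graded_fin V d s f -> Hs_graded_fin V d s g ->
  aeq (star V d s sigma f g) (star V d s sigma g f).
Proof.
move=> hsigma hf hg.
have [_ /finite_seqP [r1 e1] _] := hcompP hf.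
have [_ /finite_seqP [r2 e2] _] := hcompP hg.
pose r := undup (r1 ++ r2); have u : uniq r := undup_uniq _.
set cf := hcomp V d s f in e1 *; set cg := hcomp V d s g in e2 *.
have f0 p : p \notin r -> cf p = 0.
  rewrite mem_undup mem_cat negb_or => /andP[pr _]; apply: contrapT => /eqP cp.
  by have : [set p | cf p != 0] p by []; rewrite e1 /= (negbTE pr).
have g0 p : p \notin r -> cg p = 0.
  rewrite mem_undup mem_cat negb_or => /andP[_ pr]; apply: contrapT => /eqP cp.
  by have : [set p | cg p != 0] p by []; rewrite e2 /= (negbTE pr).
have z1 a (k : fn) : a *: ((0 : fn) \* k) = 0.
  by apply/funext => x; change (a * (0 * k x) = 0); rewrite mul0r mulr0.
have z2 a (k : fn) : a *: (k \* (0 : fn)) = 0.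
  by apply/funext => x; change (a * (k x * 0) = 0); rewrite !mulr0.
have starE c c' : (forall p, p \notin r -> c p = 0) -> (forall p, p \notin r -> c' p = 0) ->
    \sum_(p \in [set: G]) \sum_(q \in [set: G]) sigma p q *: (c p \* c' q) =
    \sum_(p <- r) \sum_(q <- r) sigma p q *: (c p \* c' q) :> fn.
  move=> c0 c'0; rewrite (fsum_setT u).
    by apply: eq_bigr => p _; apply: fsum_setT => // q qr; rewrite c'0.
  by move=> p pr; apply: fsbig1 => q _; rewrite c0.
(* The exchange pairs the term [(p, q)] of one product with the term [(q, p)] of the other. *)
rewrite /star -/cf -/cg !starE // [X in aeq _ X]exchange_big /=.
apply: aeq_sum => p; apply: aeq_sum => q.
(* Symmetry of [sigma] is known for occurring degrees. If [p] or [q] does not occur, both terms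
   vanish almost everywhere whatever their coefficients. *)
have [[a _ da]|dp] := pselect (range d p); last first.
  apply: (@aeq_trans _ _ _ _ 0); last apply: aeq_sym.
    by apply: aeq0_scalel; apply: hcomp_out => // a da; apply: dp; exists a.
  by apply: aeq0_scaler; apply: hcomp_out => // a da; apply: dp; exists a.
have [[b _ db]|dq] := pselect (range d q); last first.
  apply: (@aeq_trans _ _ _ _ 0); last apply: aeq_sym.
    by apply: aeq0_scaler; apply: hcomp_out => // b db; apply: dq; exists b.
  by apply: aeq0_scalel; apply: hcomp_out => // b db; apply: dq; exists b.
rewrite hsigma; [|by exists a|by exists b].
have -> : cf p \* cg q = cg q \* cf p by apply/funext => x /=; rewrite mulrC.
exact: aeq_refl.
Qed.

End Star.

(** * Bounded extensions to the Sobolev space *)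

Section Commutativity.
Variables (R : realType) (n : nat) (M : compact_riemannian_manifold R n).
Local Notation fn := (M -> R[i]).
Variables (I : countType) (V : I -> set fn) (hV : is_refinement V).
Variables (lam : I -> R) (lamP : forall a, spectrum M (lam a)).
Hypothesis V_eigen : forall a, V a `<=` laplace_eigenspace (lam a).
Variables (s : R) (s_ge0 : 0 <= s) (G : zmodType) (d : I -> G).
Implicit Types (f g : fn).

(** Grouping a finite expansion by degree decomposes it, each group lying trivially in the closure
    [L2_deg]. *)
Lemma Efin_graded f : @Efin R n M f -> Hs_graded_fin V d s f.
Proof.
move=> /(Efin_coords hV) [r [c [fc ->]]]; have [u Vc c0] := fc.
pose C p : fn := \sum_(j <- r | d j == p) c j.
have CA p : algsum [set a | d a = p] V (C p).
  exists [seq j <- r | d j == p], c; split; last by rewrite big_filter.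
  by move=> j; rewrite mem_filter => /andP[/eqP].
have CE p : @Efin R n M (C p).
  have [_ _ _ <-] := hV; have [r' [c' [h e]]] := CA p; exists r', c'; split => //.
  by move=> j /h [].
have CL p : inL2 (C p) by exact: (Efin_inL2 hV V_eigen).
pose D := undup (map d r).
have C0 p : p \notin D -> C p = 0.
  rewrite mem_undup => pD; rewrite /C big_seq_cond big1 // => j /andP[jr /eqP dj].
  by case/mapP: pD; exists j.
exists C; split.
- move=> p; split; first exact: (Efin_Hs hV lamP V_eigen).
  by split => // e e0; exists (C p) => //; rewrite subrr L2norm0.
- apply: (@sub_finite_set _ _ [set` D]); last exact: finite_seq.
  by move=> p /= Cp; apply: contraT => /C0 Cp0; rewrite Cp0 eqxx in Cp.
rewrite (fsum_setT (undup_uniq _) C0) comb1.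
rewrite (_ : \sum_(p <- _) C p = \sum_(j <- r) c j); first exact: aeq_refl.
rewrite /C; under eq_bigr do rewrite big_mkcond; rewrite exchange_big /=.
rewrite !big_seq; apply: eq_bigr => j jr.
rewrite (bigD1_seq (d j)) ?undup_uniq ?mem_undup ?map_f //= eqxx.
by rewrite big1 ?addr0 // => p; rewrite eq_sym => /negbTE ->.
Qed.

Section Bounded.
Variables (B : fn -> fn -> fn) (hB : bounded_bilinear s B).

(** For [f'], [g'] close to [f], [g] the first two terms are small, and the last involves
    approximants only. *)
Lemma bounded_bilinear_split f f' g g' :
  Hs s f -> Hs s f' -> Hs s g -> Hs s g' ->
  aeq (B f g) (B (f - f') g + B f' (g - g') + B f' g').
Proof.
move=> Hf Hf' Hg Hg'; have [_ Bl Br _] := hB.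
have Hff := HsB hV lamP V_eigen Hf Hf'; have Hgg := HsB hV lamP V_eigen Hg Hg'.
have := Bl 1 _ _ _ Hff Hf' Hg; rewrite !scale1r subrK => h1.
have := Br 1 _ _ _ Hf' Hgg Hg'; rewrite !scale1r subrK => h2.
apply: aeq_trans h1 _; rewrite -addrA; apply: aeqD h2; exact: aeq_refl.
Qed.

(** After splitting both products, the terms in [e k], [e' k] cancel by commutativity on [Efin];
    four small terms, bounded by [X k], remain. *)
Lemma bounded_bilinear_comm :
  (forall f g, @Efin R n M f -> @Efin R n M g -> aeq (B f g) (B g f)) ->
  forall f g, Hs s f -> Hs s g -> aeq (B f g) (B g f).
Proof.
move=> Bc f g Hf Hg; have [e ae] := Hf; have [e' ae'] := Hg.
have [BH _ _ [C hC]] := hB.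
have [Ee _ _ _] := ae; have [Ee' _ _ _] := ae'.
have toH h : @Efin R n M h -> Hs s h by exact: (Efin_Hs hV lamP V_eigen).
have HB h k : Hs s h -> Hs s k -> inL2 (B h k) by move=> Hh Hk; exact/Hs_inL2/BH.
have bnd h k : Hs s h -> Hs s k -> L2norm (B h k) <= C * Hs_norm s h * Hs_norm s k.
  move=> Hh Hk; apply: le_trans (hC _ _ Hh Hk).
  exact: (L2norm_le_Hs_norm hV lamP V_eigen s_ge0 (BH _ _ Hh Hk)).
have Lu : inL2 (B f g - B g f) by apply: inL2B; exact: HB.
apply: aeq_subr0; apply: L2norm_eq0 => //; apply/le_anti; rewrite L2norm_ge0 andbT.
pose N := @Hs_norm R n M s.
pose X k := C * N (f - e k) * N g + C * N (e k) * N (g - e' k) +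
  (C * N (g - e' k) * N f + C * N (e' k) * N (f - e k)).
have cX : X @ \oo --> (0 : R).
  have ce := Hs_norm_tail hV lamP V_eigen ae; have ce' := Hs_norm_tail hV lamP V_eigen ae'.
  have cN : (fun k => N (e k)) @ \oo --> N f.
    rewrite (_ : (fun k => N (e k)) = (fun k => Efin_norm s (e k))).
      exact: (Hs_norm_cvg hV lamP V_eigen).
    by apply/funext => k; exact: (Hs_norm_Efin hV lamP V_eigen).
  have cN' : (fun k => N (e' k)) @ \oo --> N g.
    rewrite (_ : (fun k => N (e' k)) = (fun k => Efin_norm s (e' k))).
      exact: (Hs_norm_cvg hV lamP V_eigen).
    by apply/funext => k; exact: (Hs_norm_Efin hV lamP V_eigen).
  exact: (cvg_bilinear_bound C ce ce' cN cN').
(* The defect is independent of [k]: a bound by every [X k] gives a bound by their limit [0]. *)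
rewrite -(cvg_lim _ cX) //; apply: limr_ge; first by apply/cvg_ex; exists 0.
apply: nearW => k.
have Hk := toH _ (Ee k); have Hk' := toH _ (Ee' k).
have Hfk := HsB hV lamP V_eigen Hf Hk; have Hgk := HsB hV lamP V_eigen Hg Hk'.
set T1 := B (f - e k) g; set T2 := B (e k) (g - e' k).
set T3 := B (g - e' k) f; set T4 := B (e' k) (f - e k).
have [L1 L2 L3 L4] : [/\ inL2 T1, inL2 T2, inL2 T3 & inL2 T4] by split; exact: HB.
have E : aeq (B f g - B g f) ((T1 + T2) - (T3 + T4)).
  have h1 := bounded_bilinear_split Hf Hk Hg Hk'.
  have h2 := bounded_bilinear_split Hg Hk' Hf Hk.
  have h3 := Bc _ _ (Ee k) (Ee' k).
  apply: aeS (aeI h1 (aeI h2 h3)) => x [q1 [q2 q3]].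
  change (B f g x - B g f x = (T1 x + T2 x) - (T3 x + T4 x)); rewrite q1 q2.
  change ((T1 x + T2 x + B (e k) (e' k) x) - (T3 x + T4 x + B (e' k) (e k) x) =
    (T1 x + T2 x) - (T3 x + T4 x)).
  by rewrite q3; ring.
have L12 := inL2D L1 L2; have L34 := inL2D L3 L4.
rewrite (L2norm_aeq Lu (inL2B L12 L34) E).
apply: le_trans (L2norm_triangle L12 (inL2N L34)) _; rewrite L2normN //.
apply: lerD; [apply: le_trans (L2norm_triangle L1 L2) _ | apply: le_trans (L2norm_triangle L3 L4) _];
  by apply: lerD; exact: bnd.
Qed.
End Bounded.
End Commutativity.

Unset Implicit Arguments.

Theorem corollary10p10 (R : realType) (n : nat)
  (M : compact_riemannian_manifold R n) (s : R) (hs : n%:R / 2 < s)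
  (I : countType) (V : I -> set (M -> R[i])) (hV : is_refinement V)
  (G : zmodType) (d : I -> G) (hd : channel_compatible V d)
  (hcyc : cyclic_subgroup (generated_subgroup (range d)))
  (sigma : G -> G -> R[i]) (hsigma : unitary_2cocycle sigma) :
  [/\ forall p q, generated_subgroup (range d) p ->
        generated_subgroup (range d) q -> commutator_bichar sigma p q = 1,
      forall f g, Hs_graded_fin V d s f -> Hs_graded_fin V d s g ->
        aeq (star V d s sigma f g) (star V d s sigma g f) &
      forall B : (M -> R[i]) -> (M -> R[i]) -> (M -> R[i]),
        bounded_bilinear s B ->
        (forall f g, Hs_graded_fin V d s f -> Hs_graded_fin V d s g ->
           aeq (B f g) (star V d s sigma f g)) ->
        forall f g, Hs s f -> Hs s g -> aeq (B f g) (B g f)].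
Proof.
have s0 : 0 <= s by apply: ltW; apply: le_lt_trans hs; rewrite divr_ge0.
have beta1 p q : generated_subgroup (range d) p -> generated_subgroup (range d) q ->
    commutator_bichar sigma p q = 1.
  by move=> hp hq; exact: (commutator_bichar_cyclic hsigma hcyc).
have starC f g : Hs_graded_fin V d s f -> Hs_graded_fin V d s g ->
    aeq (star V d s sigma f g) (star V d s sigma g f).
  apply: star_comm => p q hp hq.
  by apply: cocycle_sym => //; apply: beta1; exact: generated_subgroupS.
split=> // B hB Bstar.
(* A refinement only asserts that an eigenvalue exists for each [V a]; the multipliers need it as a
   function of [a]. *)
have /choice [lam hlam] : forall a, exists l, spectrum M l /\ V a `<=` laplace_eigenspace l.
  by case: hV => _ + _ _ a => /(_ a) [l sl Vl]; exists l.
have lamP a : spectrum M (lam a) by case: (hlam a).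
have Vlam a : V a `<=` laplace_eigenspace (lam a) by case: (hlam a).
apply: (bounded_bilinear_comm hV lamP Vlam s0 hB) => f g Ef Eg.
have Hf := Efin_graded hV lamP Vlam s d Ef; have Hg := Efin_graded hV lamP Vlam s d Eg.
apply: aeq_trans (Bstar _ _ Hf Hg) _; apply: aeq_trans (starC _ _ Hf Hg) _.
by apply: aeq_sym; exact: Bstar.
Qed.
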